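(* Framenability does not pass to countable subgroups: there exist a framenable group $G$ and a countable subgroup $N\le G$ such that $N$ is not framenable. Also, there exist framenable groups that do not have Haagerup's property.
   Context: ''Countable'' means countably infinite; groups are discrete. Hilbert spaces are complex and separable; $\mathcal U(H)$ is the group of unitary operators on $H$. For a unitary representation $\pi:G\to\mathcal U(H)$, $1_G\prec\pi$ means that there is a net $(v_i)_{i\in I}$ of unit vectors in $H$ with $\|\pi_g v_i-v_i\|\to0$ for every $g\in G$. A countable discrete group $G$ is framenable if there exist a unitary representation $\pi:G\to\mathcal U(H)$ with $1_G\prec\pi$, a countable (infinite) subset $S\subset G$, and a vector $v\in H$ such that $\{\pi_g v\}_{g\in S}$ is a weak frame. A family $\{f_n\}_{n\in S}$ in $H$ indexed by a countable set $S$ is a weak frame if $0<\sum_{n\in S}|\langle v,f_n\rangle|^2<\infty$ for every $v\in H$, $v\ne0$. $G$ satisfies Haagerup's property if there exists a unitary representation $\pi:G\to\mathcal U(H)$ such that $1_G\prec\pi$ and $\lim_{g\to\infty}\langle\pi_g\xi,\eta\rangle=0$ for all $\xi,\eta\in H$, i.e. for all $\xi,\eta\in H$ and $\epsilon>0$ there is a finite $E\subset G$ with $|\langle\pi_g\xi,\eta\rangle|<\epsilon$ for all $g\notin E$. *)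

(* Defs.v *)
From mathcomp Require Import all_boot all_order all_algebra.
From mathcomp Require Import complex.
From mathcomp Require Import all_classical all_reals all_analysis.

Set Implicit Arguments.
Unset Strict Implicit.
Unset Printing Implicit Defensive.

Import Order.TTheory GRing.Theory Num.Theory.
Import numFieldNormedType.Exports.

Local Open Scope classical_set_scope.
Local Open Scope card_scope.
Local Open Scope ring_scope.

(* "Countable" always means countably infinite. *)
Definition countably_infinite (T : Type) (A : set T) : Prop :=
  A #= [set: nat].

(* The library norm of a normed space over R[i] (and of R[i] itself) takes its
   values in R[i]; [rnorm] is the same norm as an element of R. *)
Definition rnorm (R : realType) (V : normedZmodType R[i]) (x : V) : R :=
  complex.Re `|x|.

(* [inner] is linear in its first argument and conjugate-linear in the
   second. *)
Record hilbertSpace (R : realType) := HilbertSpace {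
  hilbert_sort :> completeNormedModType R[i];
  inner : {dot hilbert_sort for Num.conj};
  inner_normE : forall x : hilbert_sort, `|x| ^+ 2 = inner x x;
  hilbert_separable :
    exists D : set hilbert_sort, countable D /\ dense D }.

Definition unitary (R : realType) (H : hilbertSpace R) (u : H -> H) : Prop :=
  [/\ linear u,
      (forall y, exists x, u x = y) &
      forall x y, inner H (u x) (u y) = inner H x y].

Definition unitary_rep (R : realType) (G : groupType) (H : hilbertSpace R)
    (pi : G -> H -> H) : Prop :=
  [/\ forall g, unitary (pi g),
      forall x, pi 1%g x = x &
      forall g h x, pi (g * h)%g x = pi g (pi h x)].

Definition directed (I : Type) (le : I -> I -> Prop) : Prop :=
  [/\ inhabited I,
      forall i, le i i,
      forall i j k, le i j -> le j k -> le i k &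
      forall i j, exists k, le i k /\ le j k].

(* The filter generated by the tails of a directed set: convergence of a net
   is convergence along it. *)
Definition tails (I : Type) (le : I -> I -> Prop) : set_system I :=
  filter_from [set: I] (fun i => [set j | le i j]).

(* 1_G \prec pi *)
Definition weakly_contains_trivial (R : realType) (G : groupType)
    (H : hilbertSpace R) (pi : G -> H -> H) : Prop :=
  exists (I : Type) (le : I -> I -> Prop) (v : I -> H),
    [/\ directed le,
        forall i, rnorm (v i) = 1 &
        forall g, rnorm (pi g (v i) - v i) @[i --> tails le] --> (0 : R)].

Definition weak_frame (R : realType) (T : choiceType) (H : hilbertSpace R)
    (S : set T) (f : T -> H) : Prop :=
  forall v : H, v != 0 ->
    (0 < \esum_(n in S) ((rnorm (inner H v (f n))) ^+ 2)%:E < +oo)%E.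

Definition framenable (R : realType) (G : groupType) : Prop :=
  exists (H : hilbertSpace R) (pi : G -> H -> H),
    [/\ unitary_rep pi,
        weakly_contains_trivial pi &
        exists (S : set G) (v : H),
          countably_infinite S /\ weak_frame S (fun g => pi g v)].

Definition haagerup (R : realType) (G : groupType) : Prop :=
  exists (H : hilbertSpace R) (pi : G -> H -> H),
    [/\ unitary_rep pi,
        weakly_contains_trivial pi &
        forall (xi eta : H) (eps : R), 0 < eps ->
          exists E : set G, finite_set E /\
            forall g, ~ E g -> rnorm (inner H (pi g xi) eta) < eps].

(* Main.v *)
Require Import Defs.
From HB Require Import structures.
From mathcomp Require Import all_boot all_order all_algebra.
From mathcomp Require Import complex.
From mathcomp Require Import all_classical all_reals all_analysis.
From mathcomp Require Import ring lra.

Set Implicit Arguments.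
Unset Strict Implicit.
Unset Printing Implicit Defensive.

Import Order.TTheory GRing.Theory Num.Theory.
Import numFieldNormedType.Exports.
Import ComplexField.

Local Open Scope classical_set_scope.
Local Open Scope ring_scope.
Local Open Scope complex_scope.

(** The groups are [G = GL_3(F[t]) x (F[t], +)], with [F] the field of five
    elements, and its subgroup [N] generated by the root subgroups [e_12(F)],
    [e_23(F)] and [e_31(t F)].

    [G] is framenable because it maps onto [V = (F[t], +)], an infinite locally
    finite group.  Let [G] act on the square summable functions on [V] by
    translations.  The normalized indicators of the finite subgroups of
    polynomials of bounded degree are almost invariant vectors, and the orbit
    of the Dirac function under coset representatives of the quotient is the
    canonical orthonormal basis, for which the sum of a weak frame is the
    squared norm ([framenable_of_locally_finite_quotient]).

    [N] has property (T): every unitary representation with almost invariant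
    vectors has a nonzero invariant vector [w] ([Gamma_kazhdan]).  It follows
    that [N] is not framenable: along an orbit [<w, pi_g v>] is constant, so its
    squares over an infinite set sum to zero or to infinity.  It follows also
    that [G] does not have Haagerup's property, since [w] has a constant matrix
    coefficient on the infinite subgroup [N].

    For property (T), let [P], [Q], [T] be the orthogonal projections on the
    vectors fixed by the three root subgroups.  Any two of the root subgroups
    generate a Heisenberg group over [F], the average [Z] over its centre
    commutes with [P] and [Q], and expanding the commutation relation gives
    [PQP = q^-1 P (1 - Z) + PQZ] where [q] is the order of [F].  So, away from
    the vectors fixed by both subgroups, the cosine of the angle between the
    two fixed spaces is at most [e = q^(-1/2)].  Two projections at such an
    angle satisfy
    [(1 - P)(1 - Q) + (1 - Q)(1 - P) >= - e ((1 - P) + (1 - Q))]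
    ([small_angle_anticommutator]), and summing over the three pairs gives
    [D^2 >= (1 - 2 e) D] for [D = (1 - P) + (1 - Q) + (1 - T)].  Here [q = 5]
    makes [1 - 2 e] positive.  Hence the mean [1 - D / 3] of the three
    projections contracts the energy [<D v, v>] by a constant factor
    ([mean3_contract]); iterated from an almost invariant unit vector, which
    has small energy, it converges without moving far, and the limit is a
    nonzero vector fixed by all of [N] ([triangle_invariant_vector]). *)

(** * Real norms and real inner products on complex Hilbert spaces *)

Section RealNorm.
Variables (R : realType) (V : normedZmodType R[i]).
Implicit Types x y : V.

Lemma normC x : `|x| = (rnorm x)%:C.
Proof.
rewrite /rnorm; have := normr_ge0 x; case: (`|x|) => a b.
by rewrite lecE /= => /andP[/eqP -> _].
Qed.

Lemma rnorm_ge0 x : 0 <= rnorm x.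
Proof. by have := normr_ge0 x; rewrite normC lecE /= => /andP[]. Qed.

Lemma rnorm_triangle x y : rnorm (x + y) <= rnorm x + rnorm y.
Proof. by have := ler_normD x y; rewrite !normC -rmorphD /= lecR. Qed.

Lemma rnormN x : rnorm (- x) = rnorm x.
Proof. by rewrite /rnorm normrN. Qed.

Lemma rnormB x y : rnorm (x - y) = rnorm (y - x).
Proof. by rewrite -rnormN opprB. Qed.

Lemma rnorm0 : rnorm (0 : V) = 0.
Proof. by rewrite /rnorm normr0. Qed.

Lemma rnorm0_eq0 x : rnorm x = 0 -> x = 0.
Proof. by move=> x0; apply: normr0_eq0; rewrite normC x0. Qed.

Lemma rnorm_sum (I : Type) (r : seq I) (P : pred I) (F : I -> V) :
  rnorm (\sum_(i <- r | P i) F i) <= \sum_(i <- r | P i) rnorm (F i).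
Proof.
elim/big_ind2: _ => [|x a y b xa yb|//]; first by rewrite rnorm0.
exact: (le_trans (rnorm_triangle _ _) (lerD xa yb)).
Qed.

End RealNorm.

Lemma rnormZ (R : realType) (V : normedModType R[i]) (a : R) (x : V) :
  rnorm (a%:C *: x) = `|a| * rnorm x.
Proof.
rewrite {1}/rnorm normrZ (normC x) normc_def /= expr0n addr0 sqrtr_sqr.
by rewrite mul0r subr0.
Qed.

Lemma posC_real (R : realType) (e : R[i]) :
  0 < e -> exists2 r : R, 0 < r & e = r%:C.
Proof. by case: e => r j; rewrite ltcE /= => /andP[/eqP -> r0]; exists r. Qed.

Lemma complexReD (R : realType) (z w : R[i]) :
  complex.Re (z + w) = complex.Re z + complex.Re w.
Proof. by case: z w => [a b] []. Qed.

Lemma complexReN (R : realType) (z : R[i]) : complex.Re (- z) = - complex.Re z.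
Proof. by case: z. Qed.

Lemma complexRe_conj (R : realType) (z : R[i]) :
  complex.Re (Num.conj z) = complex.Re z.
Proof. by case: z. Qed.

Section RealInner.
Variables (R : realType) (H : hilbertSpace R).
Implicit Types x y z : H.

Lemma innerC x y : inner H x y = Num.conj (inner H y x).
Proof. by have := hermC (inner H) x y; rewrite expr0 mul1r. Qed.

Lemma innerDl x y z : inner H (x + y) z = inner H x z + inner H y z.
Proof. exact: linearDl. Qed.

Lemma innerNl x y : inner H (- x) y = - inner H x y.
Proof. exact: linearNl. Qed.

Lemma innerZl (a : R[i]) x y : inner H (a *: x) y = a * inner H x y.
Proof. exact: linearZl_LR. Qed.

(** Only positivity and self-adjointness are at stake below, so the real part
    of the inner product carries all the information about norms while staying
    in an ordered field where linear arithmetic decides the estimates. *)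
Definition rdot x y : R := complex.Re (inner H x y).

Lemma rdotDl x y z : rdot (x + y) z = rdot x z + rdot y z.
Proof. by rewrite /rdot innerDl complexReD. Qed.

Lemma rdotC x y : rdot x y = rdot y x.
Proof. by rewrite /rdot innerC complexRe_conj. Qed.

Lemma rdotDr x y z : rdot x (y + z) = rdot x y + rdot x z.
Proof. by rewrite rdotC rdotDl !(rdotC x). Qed.

Lemma rdotNl x y : rdot (- x) y = - rdot x y.
Proof. by rewrite /rdot innerNl complexReN. Qed.

Lemma rdotNr x y : rdot x (- y) = - rdot x y.
Proof. by rewrite rdotC rdotNl rdotC. Qed.

Lemma rdotZl (a : R) x y : rdot (a%:C *: x) y = a * rdot x y.
Proof.
rewrite /rdot innerZl; case: (inner H x y) => b c /=.
by rewrite mul0r subr0.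
Qed.

Lemma rdotZr (a : R) x y : rdot x (a%:C *: y) = a * rdot x y.
Proof. by rewrite rdotC rdotZl rdotC. Qed.

Lemma rdot0l x : rdot 0 x = 0.
Proof. by have := rdotZl 0 0 x; rewrite scale0r mul0r. Qed.

Lemma rdot_sumr (I : Type) (r : seq I) x (F : I -> H) :
  rdot x (\sum_(i <- r) F i) = \sum_(i <- r) rdot x (F i).
Proof.
elim/big_rec2: _ => [|i y a _ <-]; last by rewrite rdotDr.
by rewrite rdotC rdot0l.
Qed.

Lemma rnorm_sq x : rnorm x ^+ 2 = rdot x x.
Proof. by rewrite /rdot -inner_normE normC -rmorphXn. Qed.

Lemma rdot_ge0 x : 0 <= rdot x x.
Proof. by rewrite -rnorm_sq sqr_ge0. Qed.

Lemma rnormE x : rnorm x = Num.sqrt (rdot x x).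
Proof. by rewrite -rnorm_sq sqrtr_sqr ger0_norm // rnorm_ge0. Qed.

End RealInner.

(** * Angles between subspaces *)

Section Projections.
Variables (R : realType) (H : hilbertSpace R).
Implicit Types (x y v : H) (P Q Z : H -> H).

Definition orthoproj P :=
  [/\ linear P, forall x, P (P x) = P x &
      forall x y, rdot (P x) y = rdot x (P y)].

Section OneProjection.
Variables (P : H -> H) (projP : orthoproj P).

Lemma projB x y : P (x - y) = P x - P y.
Proof. by case: projP => /zmod_morphism_linear lP _ _; exact: lP. Qed.

Lemma projZ a x : P (a *: x) = a *: P x.
Proof. by case: projP => /scalable_linear lP _ _; exact: lP. Qed.

Lemma rdot_proj x y : rdot (P x) (P y) = rdot (P x) y.
Proof. by case: projP => _ PP adjP; rewrite -adjP PP. Qed.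

Lemma rdot_projC x y : rdot (x - P x) (y - P y) = rdot (x - P x) y.
Proof.
case: projP => _ PP adjP.
by rewrite rdotDr rdotNr -adjP projB PP subrr rdot0l subr0.
Qed.

Lemma rdot_projC_le x : rdot (x - P x) (x - P x) <= rdot x x.
Proof.
have := rdot_ge0 (P x); rewrite rdot_projC rdotDl rdotNl rdot_proj.
lra.
Qed.

End OneProjection.

(** For orthogonal projections this is the operator inequality
    [(1 - P)(1 - Q) + (1 - Q)(1 - P) >= - e ((1 - P) + (1 - Q))], in the form
    that adds up over several pairs of projections. *)
Definition anticommutator_bound (e : R) P Q := forall v,
  - (e * (rdot (v - P v) (v - P v) + rdot (v - Q v) (v - Q v)))
  <= 2 * rdot (v - P v) (v - Q v).

Section TwoProjections.
Variables (e : R) (P Q E : H -> H).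
Hypotheses (projP : orthoproj P) (projQ : orthoproj Q) (linE : linear E).
Hypotheses (PE : forall x, P (E x) = E x) (QE : forall x, Q (E x) = E x).
Hypotheses (EE : forall x, E (E x) = E x).
Hypotheses (e_gt0 : 0 < e) (e_le1 : e <= 1).
Hypothesis cosPQ : forall x, E x = 0 ->
  rdot (Q (P x)) (Q (P x)) <= e ^+ 2 * rdot (P x) (P x).

Lemma rdot_amgm x y : 2 * rdot x y <= rdot x x / e + e * rdot y y.
Proof.
have := rdot_ge0 (x - e%:C *: y).
rewrite rdotDl !rdotDr !rdotNl !rdotNr !rdotZl !rdotZr (rdotC y) => h.
have : 0 <= (rdot x x - 2 * e * rdot x y + e ^+ 2 * rdot y y) / e.
  by apply: divr_ge0; [lra | exact: ltW].
have -> : (rdot x x - 2 * e * rdot x y + e ^+ 2 * rdot y y) / e =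
  rdot x x / e + e * rdot y y - 2 * rdot x y.
  by field; rewrite gt_eqF.
lra.
Qed.

(** [E] stands for the projection on the intersection of the two ranges.  As
    [1 - P] and [1 - Q] kill its range, one may assume [E v = 0].  There
    [S = P + Q] satisfies [S^2 <= (1 + e) S], hence [S <= 1 + e], and the
    inequality reads
    [0 <= (2 - S)(1 + e - S) = (1 + e - S)^2 + (1 - e)(1 + e - S)]. *)
Lemma small_angle_anticommutator : anticommutator_bound e P Q.
Proof.
move=> v.
have [u [-> -> Eu]] : exists u,
    [/\ v - P v = u - P u, v - Q v = u - Q u & E u = 0].
  exists (v - E v); rewrite (projB projP) PE (projB projQ) QE.
  by rewrite (zmod_morphism_linear linE) EE subrr !opprB !addrA !subrK.
have hP := rdot_projC projP u u; have hQ := rdot_projC projQ u u.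
rewrite {}hP {}hQ.
have ab : 2 * rdot (P u) (Q u) <= e * (rdot (P u) (P u) + rdot (Q u) (Q u)).
  have -> : rdot (P u) (Q u) = rdot (Q (P u)) (Q u).
    by rewrite rdot_proj //; case: projQ => _ _ ->.
  apply: (le_trans (rdot_amgm _ _)); rewrite mulrDr lerD2r.
  rewrite ler_pdivrMr // (le_trans (cosPQ Eu)) // expr2 -!mulrA.
  by rewrite (mulrC e (rdot _ _)).
(* [hX] is the nonnegativity of [(1 + e - S)^2], [Y] below that of [1 + e - S]. *)
have hX := rdot_ge0 ((1 + e)%:C *: u - (P u + Q u)).
have uP := rdot_proj projP u u; have uQ := rdot_proj projQ u u.
move: hX; rewrite !(rdotDl, rdotDr, rdotNl, rdotNr, rdotZl, rdotZr).
rewrite (rdotC u (P u)) (rdotC u (Q u)) (rdotC (Q u) (P u)) -uP -uQ.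
set a := rdot (P u) (P u); set b := rdot (Q u) (Q u).
set c := rdot (P u) (Q u); set n := rdot u u => hX.
have {}ab : 2 * c <= e * (a + b) by [].
have Y : 0 <= (1 + e) * n - (a + b).
  have : 0 <= (1 + e) * ((1 + e) * n - (a + b)) by lra.
  by rewrite pmulr_rge0 // ltr_wpDl.
have : 0 <= (1 - e) * ((1 + e) * n - (a + b)) by rewrite mulr_ge0 // subr_ge0.
lra.
Qed.

End TwoProjections.

Section ThreeProjections.
Variables (e : R) (P Q T : H -> H).
Hypotheses (projP : orthoproj P) (projQ : orthoproj Q) (projT : orthoproj T).
Hypotheses (PQ : anticommutator_bound e P Q) (QT : anticommutator_bound e Q T).
Hypothesis TP : anticommutator_bound e T P.

(** The quadratic form of the Laplacian [lap] below. *)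
Definition energy v := rdot (v - P v) (v - P v) + rdot (v - Q v) (v - Q v) +
  rdot (v - T v) (v - T v).

Definition mean3 v := 3^-1%:C *: (P v + Q v + T v).

Lemma energy_ge0 v : 0 <= energy v.
Proof. by rewrite !addr_ge0 ?rdot_ge0. Qed.

Let lap v := (v - P v) + (v - Q v) + (v - T v).

Let mean3E v : mean3 v = v - 3^-1%:C *: lap v.
Proof.
have -> : lap v = v *+ 3 - (P v + Q v + T v).
  by rewrite /lap !opprD !mulrS mulr0n addr0 !addrA (ACl (1*3*5*2*4*6)).
rewrite scalerBr -(scaler_nat 3 v) scalerA.
have -> : (3^-1)%:C * 3%:R = 1 :> R[i].
  by rewrite -(rmorph_nat (real_complex R)) -rmorphM mulVf ?pnatr_eq0.
by rewrite scale1r opprB addrCA subrr addr0.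
Qed.

Let rdot_lap x y : rdot (lap x) y = rdot (x - P x) (y - P y) +
  rdot (x - Q x) (y - Q y) + rdot (x - T x) (y - T y).
Proof. by rewrite /lap !rdot_projC // -!rdotDl. Qed.

Let rdot_lapC x y : rdot (lap x) y = rdot x (lap y).
Proof.
by rewrite (rdotC x) !rdot_lap (rdotC (x - P x)) (rdotC (x - Q x)) (rdotC (x - T x)).
Qed.

Let lapB x y : lap (x - y) = lap x - lap y.
Proof.
have subACA (a b c d : H) : a - b - (c - d) = a - c - (b - d).
  by rewrite !opprB addrACA [RHS]addrACA (addrC (- b)).
rewrite /lap (projB projP) (projB projQ) (projB projT).
rewrite (subACA _ _ (P x)) (subACA _ _ (Q x)) (subACA _ _ (T x)).
move: (x - P x) (x - Q x) (x - T x) (y - P y) (y - Q y) (y - T y) => a b c a' b' c'.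
by rewrite !opprD [RHS]addrACA [X in _ = X + _]addrACA.
Qed.

Let lapZ a x : lap (a *: x) = a *: lap x.
Proof. by rewrite /lap (projZ projP) (projZ projQ) (projZ projT) -!scalerBr -!scalerDr. Qed.

Let energyE v : energy v = rdot (lap v) v.
Proof. by rewrite rdot_lap. Qed.

Let energy_le3 x : energy x <= 3 * rdot x x.
Proof.
rewrite /energy; have := rdot_projC_le projP x.
have := rdot_projC_le projQ x; have := rdot_projC_le projT x; lra.
Qed.

(** Squaring the Laplacian produces its diagonal, which is the energy, plus the
    three anticommutators, each bounded below by hypothesis. *)
Let lap_ge v : (1 - 2 * e) * energy v <= rdot (lap v) (lap v).
Proof.
have := PQ v; have := QT v; have := TP v.
rewrite /energy /lap.
move: (v - P v) (v - Q v) (v - T v) => a b c.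
by rewrite !(rdotDl, rdotDr) (rdotC b a) (rdotC c b) (rdotC c a); lra.
Qed.

Let lap_le v : rdot (lap v) (lap v) <= 3 * energy v.
Proof.
rewrite /energy /lap.
move: (v - P v) (v - Q v) (v - T v) => a b c.
have := rdot_ge0 (a - b); have := rdot_ge0 (b - c); have := rdot_ge0 (a - c).
rewrite !(rdotDl, rdotDr, rdotNl, rdotNr).
by rewrite (rdotC b a) (rdotC c b) (rdotC c a); lra.
Qed.

(** With [D = lap] and [v' = v - D v / 3], the energy [<D v', v'>] expands to
    [<D v, v> - (2 / 3) |D v|^2 + (1 / 9) <D (D v), D v>]; the last term is at
    most [|D v|^2 / 3] as [D <= 3], and [|D v|^2 >= (1 - 2 e) <D v, v>]. *)
Lemma mean3_contract v : energy (mean3 v) <= (2 + 2 * e) / 3 * energy v.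
Proof.
rewrite energyE mean3E lapB lapZ rdotDl !rdotDr !rdotNl !rdotNr.
rewrite !rdotZl !rdotZr -energyE (rdot_lapC (lap v) v) -energyE.
have := energy_le3 (lap v); have := lap_ge v.
set x := rdot (lap v) (lap v); set y := energy (lap v); set z := energy v.
lra.
Qed.

Lemma mean3_dist v : rnorm (mean3 v - v) <= Num.sqrt (energy v).
Proof.
rewrite rnormE ler_sqrt ?energy_ge0 //.
have -> : mean3 v - v = - (3^-1%:C *: lap v).
  by rewrite mean3E addrC addKr.
rewrite rdotNl rdotNr opprK rdotZl rdotZr.
have := lap_le v; have := energy_ge0 v.
by move: (energy v) (rdot _ _) => a b; lra.
Qed.

End ThreeProjections.
End Projections.

(** * Geometric convergence *)

(** The factor [1 - rho] in the hypothesis is chosen so that the steps from [n]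
    on add up to exactly [K * rho ^+ n]. *)
Lemma geometric_cvg (R : realType) (V : completeNormedModType R[i])
    (u : nat -> V) (K rho : R) : 0 <= rho < 1 ->
    (forall n, rnorm (u n.+1 - u n) <= K * (1 - rho) * rho ^+ n) ->
  exists2 l, forall n, rnorm (l - u n) <= K * rho ^+ n &
    K * rho ^+ n @[n --> \oo] --> (0 : R).
Proof.
move=> /andP[rho0 rho1] uS.
have Krho : K * rho ^+ n @[n --> \oo] --> (0 : R).
  rewrite -(mulr0 K); apply: cvgM; first exact: cvg_cst.
  by apply: cvg_expr; rewrite ger0_norm.
have uD k : forall n, rnorm (u (n + k)%N - u n) <= K * rho ^+ n.
  elim: k => [|k IHk] n.
    rewrite addn0 subrr rnorm0.
    have := le_trans (rnorm_ge0 _) (uS n).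
    rewrite (mulrC K) -mulrA pmulr_rge0 // subr_gt0 //.
  rewrite -[u (n + _)%N](subrK (u n.+1)) -addrA addnS -addSn.
  apply: (le_trans (rnorm_triangle _ _)).
  apply: (le_trans (lerD (IHk n.+1) (uS n))).
  by rewrite exprS le_eqVlt; apply/orP; left; apply/eqP; ring.
have /cauchy_cvg/cvg_ex[l ul] : cauchy (u @ \oo).
  apply: cauchy_exP => eps /posC_real[r r0 ->].
  have /cvgrPdist_lt/(_ _ r0)[n _ /(_ n (leqnn n))] := Krho.
  rewrite sub0r normrN /= => nr; exists (u n); exists n => // m /= nm.
  rewrite -ball_normE /= distrC normC ltcR (le_lt_trans _ nr) // -(subnKC nm).
  exact: le_trans (uD _ _) (ler_norm _).
exists l => // n; apply/ler_addgt0Pr => r r0.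
have r0' : 0 < r%:C by rewrite ltcR.
have /cvgrPdist_lt/(_ _ r0')[m _ /(_ (n + m)%N (leq_addl _ _))] := ul.
rewrite normC ltcR => lm.
rewrite -[l](subrK (u (n + m)%N)) -addrA addrC.
apply: (le_trans (rnorm_triangle _ _)); rewrite addrC lerD ?(ltW lm) //.
by rewrite addrC.
Qed.

(** * Averages over root subgroups *)

Lemma linear_bigsum (K : pzRingType) (U V : lmodType K) (f : U -> V) :
  linear f -> forall (I : Type) (r : seq I) (F : I -> U),
  f (\sum_(i <- r) F i) = \sum_(i <- r) f (F i).
Proof.
move=> lf I r F; have fB := zmod_morphism_linear lf.
apply: big_morph => [x y|]; last by rewrite -(subrr 0) fB subrr.
by have := lf 1 x y; rewrite !scale1r.
Qed.

Section Averages.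
Variables (R : realType) (G : groupType) (H : hilbertSpace R).
Variables (pi : G -> H -> H) (pi_rep : unitary_rep pi) (F : finFieldType).
Implicit Types (x y z : F -> G) (v w : H).

Definition additive_hom x := forall a b, x (a + b) = (x a * x b)%g.

Let q : R := #|F|%:R.

Definition avg x v : H := q^-1%:C *: \sum_a pi (x a) v.

Let q_neq0 : q != 0.
Proof. by rewrite pnatr_eq0 -lt0n (cardD1 0) inE. Qed.

Let rep1 v : pi 1%g v = v. Proof. by case: pi_rep. Qed.
Let repM g h v : pi (g * h)%g v = pi g (pi h v). Proof. by case: pi_rep. Qed.
Let rep_lin g : linear (pi g). Proof. by case: pi_rep => /(_ g)[]. Qed.

Lemma rep_rdot g v w : rdot (pi g v) (pi g w) = rdot v w.
Proof. by case: pi_rep => /(_ g)[_ _ piE] _ _; rewrite /rdot piE. Qed.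

Lemma rep_rdotV g v w : rdot (pi g v) w = rdot v (pi g^-1%g w).
Proof. by rewrite -(rep_rdot g^-1%g) -repM mulVg rep1. Qed.

Lemma additive_hom0 x : additive_hom x -> x 0 = 1%g.
Proof. by move=> xD; apply: (mulgI (x 0)); rewrite -xD addr0 mulg1. Qed.

Lemma additive_homN x a : additive_hom x -> x (- a) = (x a)^-1%g.
Proof.
move=> xD; apply: (mulgI (x a)).
by rewrite -xD subrr mulgV additive_hom0.
Qed.

Lemma scale_mean_const v : q^-1%:C *: \sum_(a : F) v = v.
Proof.
rewrite sumr_const -scaler_nat scalerA.
by rewrite -(rmorph_nat (real_complex R)) -rmorphM mulVf // scale1r.
Qed.

Lemma avg_linear x : linear (avg x).
Proof.
move=> a v w; rewrite /avg scalerA mulrC -scalerA -scalerDr; congr (_ *: _).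
by rewrite scaler_sumr -big_split; apply: eq_bigr => c _; rewrite rep_lin.
Qed.

Lemma avg_rep x a v : additive_hom x -> avg x (pi (x a) v) = avg x v.
Proof.
move=> xD; rewrite /avg; congr (_ *: _).
rewrite [RHS](reindex_inj (addIr a)); apply: eq_bigr => b _.
by rewrite -repM -xD.
Qed.

Lemma rep_lin_avg g x v : pi g (avg x v) = q^-1%:C *: \sum_a pi g (pi (x a) v).
Proof.
by rewrite /avg (scalable_linear (rep_lin g)) (linear_bigsum (rep_lin g)).
Qed.

Lemma rep_avg x a v : additive_hom x -> pi (x a) (avg x v) = avg x v.
Proof.
move=> xD; rewrite rep_lin_avg /avg; congr (_ *: _).
rewrite [RHS](reindex_inj (addrI a)); apply: eq_bigr => b _.
by rewrite -repM -xD.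
Qed.

Lemma avg_fix x v : (forall a, pi (x a) v = v) -> avg x v = v.
Proof.
by move=> xv; rewrite /avg (eq_bigr (fun=> v)) ?scale_mean_const // => a _.
Qed.

Lemma avg_proj x : additive_hom x -> orthoproj (avg x).
Proof.
move=> xD; split; first exact: avg_linear.
  by move=> v; apply: avg_fix => a; rewrite rep_avg.
move=> v w; rewrite rdotZl rdotZr rdotC !rdot_sumr; congr (_ * _).
rewrite [RHS](reindex_inj oppr_inj); apply: eq_bigr => a _.
by rewrite additive_homN // -rep_rdotV rdotC.
Qed.

Lemma avg_comm_rep z g v : (forall c, commute (z c) g) ->
  avg z (pi g v) = pi g (avg z v).
Proof.
move=> zg; rewrite rep_lin_avg; congr (_ *: _); apply: eq_bigr => c _.
by rewrite -!repM zg.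
Qed.

Lemma avg_comm x z v : (forall c a, commute (z c) (x a)) ->
  avg z (avg x v) = avg x (avg z v).
Proof.
move=> zx; rewrite {2}/avg (scalable_linear (avg_linear z)).
rewrite (linear_bigsum (avg_linear z)); congr (_ *: _).
by apply: eq_bigr => a _; rewrite avg_comm_rep.
Qed.

Lemma avg_displacement x v d :
  (forall a, rnorm (pi (x a) v - v) <= d) -> rnorm (v - avg x v) <= d.
Proof.
move=> xv; rewrite rnormB -{2}[v]scale_mean_const -scalerBr -sumrB rnormZ.
rewrite ger0_norm ?invr_ge0 ?ler0n // mulrC ler_pdivrMr; last first.
  by rewrite lt_def q_neq0 ler0n.
apply: (le_trans (rnorm_sum _ _ _)).
apply: (le_trans (ler_sum _ (fun a _ => xv a))).
by rewrite sumr_const mulr_natr.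
Qed.

(** [x], [y], [z] parametrize the two noncentral root subgroups and the centre
    of an image of the Heisenberg group over [F]. *)
Definition heisenberg x y z :=
  [/\ [/\ additive_hom x, additive_hom y & additive_hom z],
      forall a b, (x a * y b)%g = (y b * x a * z (a * b)%R)%g,
      forall c a, commute (z c) (x a) & forall c b, commute (z c) (y b)].

Section Heisenberg.
Variables (x y z : F -> G) (xyz : heisenberg x y z).

Let xD : additive_hom x. Proof. by case: xyz => -[]. Qed.
Let yD : additive_hom y. Proof. by case: xyz => -[]. Qed.
Let zD : additive_hom z. Proof. by case: xyz => -[]. Qed.
Let zx c a : commute (z c) (x a). Proof. by case: xyz. Qed.
Let zy c b : commute (z c) (y b). Proof. by case: xyz. Qed.
Let yx a b : (y b * x a)%g = (x a * y b * z (- (a * b))%R)%g.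
Proof. by case: xyz => _ -> _ _; rewrite -mulgA -zD subrr additive_hom0 // mulg1. Qed.

Let P := avg x.
Let Q := avg y.
Let Z := avg z.

Let PQZ_swap v : Q (P (Z v)) = P (Q (Z v)).
Proof.
rewrite /P /Q {1}/avg [in RHS]/avg; congr (_ *: _).
under eq_bigr do rewrite rep_lin_avg.
under [in RHS]eq_bigr do rewrite rep_lin_avg.
rewrite -!scaler_sumr exchange_big; congr (_ *: _).
apply: eq_bigr => a _; apply: eq_bigr => b _.
by rewrite -repM yx !repM /Z rep_avg.
Qed.

(** [P Q P] is the mean over [b] of [P y_b P].  Moving [x_c] to the left of
    [y_b] turns [P y_b P] into the mean over [c] of [P y_b z_(- c b)].  For
    [b != 0] the map [c |-> - c b] is a bijection of [F], so that mean is
    [P y_b Z]; the single value [b = 0] contributes [P] instead, which is the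
    origin of the term with the factor [q^-1]. *)
Let PQP v : P (Q (P v)) = q^-1%:C *: (P v - P (Z v)) + P (Q (Z v)).
Proof.
have P_avg (f : F -> H) :
    P (q^-1%:C *: \sum_b f b) = q^-1%:C *: \sum_b P (f b).
  rewrite /P (scalable_linear (avg_linear x)).
  by rewrite (linear_bigsum (avg_linear x)).
have step b : P (pi (y b) (P v)) = if b == 0 then P v else P (pi (y b) (Z v)).
  have [->|b0] := eqVneq.
    by rewrite additive_hom0 // rep1 /P; case: (avg_proj xD).
  rewrite /Z {2}/P !rep_lin_avg !P_avg; congr (_ *: _).
  have binj : injective (fun c => - (c * b)).
    by move=> c c' /oppr_inj /(mulIf b0).
  rewrite [RHS](reindex_inj binj); apply: eq_bigr => c _.
  by rewrite -repM yx !repM /P avg_rep.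
have QE u : Q u = q^-1%:C *: \sum_b pi (y b) u by [].
rewrite !QE (P_avg (fun b => pi (y b) (P v))) (P_avg (fun b => pi (y b) (Z v))).
rewrite -scalerDr; congr (_ *: _).
under eq_bigr do rewrite step.
rewrite (bigD1 0) //= eqxx [X in _ = _ + X](bigD1 0) //= additive_hom0 // rep1.
rewrite addrA subrK; congr (_ + _).
by apply: eq_bigr => b /negPf ->.
Qed.

(** [P Q Z] is the average over the whole Heisenberg group.  On its kernel,
    [PQP] says that [|Q P u|^2 = <P Q P u, P u>] is
    [q^-1 (|P u|^2 - |Z P u|^2)], which bounds the cosine of the angle. *)
Lemma heisenberg_anticommutator : anticommutator_bound (Num.sqrt q^-1) P Q.
Proof.
have pP : orthoproj P := avg_proj xD; have pQ : orthoproj Q := avg_proj yD.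
have pZ : orthoproj Z := avg_proj zD.
have PP u : P (P u) = P u by case: pP.
have QQ u : Q (Q u) = Q u by case: pQ.
have ZZ u : Z (Z u) = Z u by case: pZ.
have ZP u : Z (P u) = P (Z u) by exact: avg_comm.
have ZQ u : Z (Q u) = Q (Z u) by exact: avg_comm.
have q0 : 0 < q^-1 by rewrite invr_gt0 lt_def q_neq0 ler0n.
pose E u := P (Q (Z u)).
have PE u : P (E u) = E u by rewrite /E PP.
have QE u : Q (E u) = E u by rewrite /E -ZQ PQZ_swap ZQ QQ.
have ZE u : Z (E u) = E u by rewrite /E ZP ZQ ZZ.
apply: (small_angle_anticommutator (E := E)) => //.
- by move=> a u w; rewrite /E /P /Q /Z !avg_linear.
- by move=> u; rewrite {1}/E ZE QE PE.
- by rewrite sqrtr_gt0.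
- rewrite -[leRHS]sqrtr1 ler_wsqrtr // invf_le1 -1?invr_gt0 // ler1n.
  by rewrite (cardD1 0) inE.
move=> u Eu; rewrite sqr_sqrtr ?(ltW q0) //.
have -> : rdot (Q (P u)) (Q (P u)) = rdot (P (Q (P u))) (P u).
  by case: (pP) => _ _ ->; rewrite PP (rdot_proj pQ).
rewrite PQP -/(E u) Eu addr0 rdotZl ler_wpM2l ?(ltW q0) //.
rewrite rdotDl rdotNl lerBlDr lerDl -ZP.
by rewrite -(rdot_proj pZ) rdot_ge0.
Qed.

End Heisenberg.
End Averages.

(** * Invariant vectors for triangles of Heisenberg groups *)

Section KazhdanTriangle.
Variables (R : realType) (G : groupType) (H : hilbertSpace R).
Variables (pi : G -> H -> H).

(** A net that is almost invariant for each group element separately is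
    eventually so for finitely many elements at once. *)
Lemma almost_invariant_vector (I : finType) (g : I -> G) (d : R) :
  weakly_contains_trivial pi -> 0 < d ->
  exists2 v : H, rnorm v = 1 & forall i, rnorm (pi (g i) v - v) < d.
Proof.
move=> [J [le [v [[[j0] lexx letr ledir] v1 vcvg]]]] d0.
have fil : Filter (tails le).
  apply: filter_from_filter; first by exists j0.
  move=> i j _ _; have [k [ik jk]] := ledir i j.
  by exists k => // l kl; split; [exact: letr ik kl|exact: letr jk kl].
have : \forall j \near tails le, forall i, rnorm (pi (g i) (v j) - v j) < d.
  apply: filter_forall => i.
  have /cvgrPdist_lt/(_ _ d0) := vcvg (g i).
  by apply: filterS => j; rewrite sub0r normrN ger0_norm // rnorm_ge0.
by move=> [k _ /(_ k (lexx k))] vk; exists (v k).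
Qed.

(** The iterates of the mean of the three projections move geometrically less
    and less, since a step is bounded by the square root of the energy; the
    starting vector is taken invariant enough for the total displacement to be
    smaller than its norm. *)
Lemma triangle_invariant_vector (F : finFieldType) (x y t xy yt tx : F -> G) :
  (4 < #|F|)%N -> heisenberg x y xy -> heisenberg y t yt -> heisenberg t x tx ->
  unitary_rep pi -> weakly_contains_trivial pi ->
  exists w : H, [/\ w != 0, forall a, pi (x a) w = w,
    forall a, pi (y a) w = w & forall a, pi (t a) w = w].
Proof.
move=> q4 hxy hyt htx pi_rep pi_triv.
pose e : R := Num.sqrt (#|F|%:R)^-1.
have e0 : 0 <= e by rewrite sqrtr_ge0.
have e12 : e < 2^-1.
  rewrite -[ltRHS]ger0_norm ?invr_ge0 // -sqrtr_sqr ltr_sqrt.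
    rewrite expr2 -invfM -natrM ltf_pV2 ?posrE ?ltr0n ?ltr_nat //.
    exact: leq_trans q4.
  by rewrite exprn_gt0 // invr_gt0.
pose P := avg pi x; pose Q := avg pi y; pose T := avg pi t.
have [[xD yD _] _ _ _] := hxy; have [[_ tD _] _ _ _] := hyt.
have pP : orthoproj P := avg_proj pi_rep xD.
have pQ : orthoproj Q := avg_proj pi_rep yD.
have pT : orthoproj T := avg_proj pi_rep tD.
have gPQ := heisenberg_anticommutator pi_rep hxy.
have gQT := heisenberg_anticommutator pi_rep hyt.
have gTP := heisenberg_anticommutator pi_rep htx.
pose ener := energy P Q T; pose rho := Num.sqrt ((2 + 2 * e) / 3).
have rho0 : 0 <= rho by rewrite sqrtr_ge0.
have rho1 : rho < 1.
  by rewrite -[ltRHS]sqrtr1 ltr_sqrt // ltr_pdivrMr //; lra.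
(* The energy of a vector displaced by at most [d] is at most [3 d^2], which
   must be less than [(1 - rho)^2] for the total displacement [K] below to be
   less than [1]. *)
pose d := (1 - rho) / 2.
have d0 : 0 < d by rewrite divr_gt0 // subr_gt0.
pose g (i : F + F + F) := match i with
  | inl (inl a) => x a | inl (inr a) => y a | inr a => t a end.
have [v v1 vd] := almost_invariant_vector g pi_triv d0.
have ener_v : Num.sqrt (ener v) < 1 - rho.
  have small (s : F -> G) : (forall a, exists i, s a = g i) ->
    rdot (v - avg pi s v) (v - avg pi s v) <= d ^+ 2.
    move=> sg; rewrite -rnorm_sq lerXn2r ?nnegrE ?rnorm_ge0 ?(ltW d0) //.
    apply: avg_displacement => a; have [i ->] := sg a; exact/ltW.
  have sP : rdot (v - P v) (v - P v) <= d ^+ 2.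
    by apply: small => a; exists (inl (inl a)).
  have sQ : rdot (v - Q v) (v - Q v) <= d ^+ 2.
    by apply: small => a; exists (inl (inr a)).
  have sT : rdot (v - T v) (v - T v) <= d ^+ 2.
    by apply: small => a; exists (inr a).
  have rho1' : 0 < 1 - rho by rewrite subr_gt0.
  rewrite -[ltRHS]ger0_norm ?(ltW rho1') // -sqrtr_sqr ltr_sqrt ?exprn_gt0 //.
  have -> : (1 - rho) ^+ 2 = 4 * d ^+ 2 by rewrite /d; field.
  have : 0 < d ^+ 2 by rewrite exprn_gt0.
  rewrite /ener /energy; lra.
pose u n := iter n (mean3 P Q T) v.
have ener_u n : ener (u n) <= ((2 + 2 * e) / 3) ^+ n * ener v.
  elim: n => [|n IHn]; first by rewrite expr0 mul1r.
  rewrite exprS -mulrA; apply: le_trans (ler_wpM2l _ IHn); last first.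
    by rewrite divr_ge0 // addr_ge0 // mulr_ge0.
  exact: (mean3_contract pP pQ pT gPQ gQT gTP).
have sqrt_u n : Num.sqrt (ener (u n)) <= Num.sqrt (ener v) * rho ^+ n.
  apply: (le_trans (ler_wsqrtr (ener_u n))); rewrite mulrC.
  rewrite sqrtrM ?energy_ge0 // ler_wpM2l ?sqrtr_ge0 //.
  elim: n => [|n IHn]; first by rewrite !expr0 sqrtr1.
  rewrite !exprS sqrtrM ?ler_wpM2l //.
  by rewrite divr_ge0 // addr_ge0 // mulr_ge0.
pose K := Num.sqrt (ener v) / (1 - rho).
have KE : K * (1 - rho) = Num.sqrt (ener v).
  by rewrite /K divfK // subr_eq0 gt_eqF.
have K1 : K < 1 by rewrite /K ltr_pdivrMr ?mul1r // subr_gt0.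
have K0 : 0 <= K by apply: divr_ge0; rewrite ?sqrtr_ge0 // subr_ge0 ltW.
have rho01 : 0 <= rho < 1 by rewrite rho0 rho1.
have [|w wu Krho] := @geometric_cvg _ _ u K rho rho01.
  move=> n; rewrite KE; apply: le_trans (sqrt_u n).
  exact: mean3_dist.
have w_fix S : orthoproj S -> (forall z, rdot (z - S z) (z - S z) <= ener z) ->
    S w = w.
  move=> pS Sener; apply/eqP; rewrite eq_sym -subr_eq0; apply/eqP.
  apply: rnorm0_eq0; apply/eqP; rewrite eq_le rnorm_ge0 andbT.
  apply/ler_addgt0Pr => r r0; rewrite add0r.
  have r20 : 0 < r / 2 by rewrite divr_gt0.
  have /cvgrPdist_lt/(_ _ r20)[n _ /(_ n (leqnn n))] := Krho.
  have Kn : 0 <= K * rho ^+ n by rewrite (mulr_ge0 K0) ?exprn_ge0.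
  rewrite sub0r normrN ger0_norm // => nr.
  have -> : w - S w = (w - u n - S (w - u n)) + (u n - S (u n)).
    rewrite (projB pS) opprB (addrC (S (u n))) [X in _ = X + _]addrACA.
    rewrite (addrC (- u n)).
    by rewrite -(opprB (u n)) subrK.
  apply: (le_trans (rnorm_triangle _ _)).
  have h1 : rnorm (w - u n - S (w - u n)) <= K * rho ^+ n.
    apply: le_trans (wu n); rewrite !rnormE; apply: ler_wsqrtr.
    exact: rdot_projC_le.
  have h2 : rnorm (u n - S (u n)) <= K * rho ^+ n.
    rewrite rnormE; apply: (le_trans (ler_wsqrtr (Sener _))).
    apply: (le_trans (sqrt_u n)); rewrite ler_wpM2r ?exprn_ge0 //.
    by rewrite -KE ler_piMr // gerBl.
  lra.
have Pw : P w = w.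
  by apply: w_fix => // z; rewrite /ener /energy -addrA lerDl addr_ge0 ?rdot_ge0.
have Qw : Q w = w.
  apply: w_fix => // z; rewrite /ener /energy addrAC lerDr.
  by rewrite addr_ge0 ?rdot_ge0.
have Tw : T w = w.
  by apply: w_fix => // z; rewrite /ener /energy lerDr addr_ge0 ?rdot_ge0.
exists w; split.
- apply: contraTneq (wu 0) => ->; rewrite sub0r rnormN v1 expr0 mulr1.
  by rewrite -ltNge.
- by move=> a; rewrite -Pw rep_avg.
- by move=> a; rewrite -Qw rep_avg.
- by move=> a; rewrite -Tw rep_avg.
Qed.

End KazhdanTriangle.

(** * Invariant vectors against weak frames and mixing *)

Section Esum.
Variables (R : realType) (T : choiceType).
Implicit Types (I : set T) (a : T -> R).

Lemma esum_ge_seq I a (s : seq T) : uniq s -> (forall t, t \in s -> I t) ->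
  ((\sum_(t <- s) a t)%:E <= \esum_(t in I) (a t)%:E)%E.
Proof.
move=> us sI; apply: esum_ge; exists [set` s].
  by split; [exact: finite_seq|move=> t /= /sI].
by rewrite -fsbig_seq // sumEFin.
Qed.

Lemma esum_le_seq I a (c : R) :
  (forall s : seq T, uniq s -> (forall t, t \in s -> I t) ->
    \sum_(t <- s) a t <= c) ->
  (\esum_(t in I) (a t)%:E <= c%:E)%E.
Proof.
move=> ac; apply: ge_ereal_sup => _ [X [finX XI] <-].
rewrite fsbig_finite //= sumEFin lee_fin; apply: ac => // t.
by rewrite in_fset_set // inE => /XI.
Qed.

Lemma esum_const_infinite I (c : R) : infinite_set I -> 0 < c ->
  \esum_(t in I) c%:E = +oo%E.
Proof.
move=> infI c0; apply/eqyP => _/posnumP[b].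
have [n bn] : exists n : nat, b%:num <= c *+ n.
  exists (Num.truncn (b%:num / c)).+1.
  by rewrite -mulr_natr -ler_pdivrMl // mulrC ltW // truncnS_gt.
have [X XI nX] := infinite_set_fset n infI.
have := @esum_ge_seq I (fun=> c) (finmap.enum_fset X) (finmap.fset_uniq X) XI.
move/(le_trans _); apply.
rewrite lee_fin (le_trans bn) // big_const_seq count_predT iter_addr addr0.
by rewrite ler_wpMn2l // ltW.
Qed.

End Esum.

Section PropertyT.
Variable R : realType.

(** Property (T), for separable representations. *)
Definition kazhdan (G : groupType) :=
  forall (H : hilbertSpace R) (pi : G -> H -> H),
    unitary_rep pi -> weakly_contains_trivial pi ->
  exists2 w : H, w != 0 & forall g, pi g w = w.

Lemma infinite_countably_infinite (T : Type) (A : set T) :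
  countably_infinite A -> infinite_set A.
Proof. by rewrite /countably_infinite => /card_eqPle [_ ?]; apply/infiniteP. Qed.

(** Against an invariant vector the terms of the series of a frame made of
    orbit points are all equal. *)
Lemma kazhdan_not_framenable (G : groupType) : kazhdan G -> ~ framenable R G.
Proof.
move=> kG [H [pi [pi_rep pi_triv [S [v [Sinf]]]]]] /=.
have [w w0 winv] := kG _ _ pi_rep pi_triv.
move=> /(_ _ w0).
have const g : (rnorm (inner H w (pi g v)) ^+ 2) = rnorm (inner H w v) ^+ 2.
  by rewrite -{1}(winv g); case: pi_rep => /(_ g)[_ _ ->].
rewrite (eq_esum (b := fun=> (rnorm (inner H w v) ^+ 2)%:E)); last first.
  by move=> g _; rewrite const.
have := sqr_ge0 (rnorm (inner H w v)); rewrite le_eqVlt => /orP[/eqP <-|c0].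
  by rewrite esum1 // ltxx.
rewrite esum_const_infinite //; first by rewrite ltxx andbF.
exact: infinite_countably_infinite.
Qed.

(** Restricting a representation of [G] to [N] gives a vector [w] with
    [<pi_n w, w> = |w|^2] for all [n] in [N]. *)
Lemma kazhdan_subgroup_not_haagerup (G : groupType) (P : pred G)
    (N : subGroupType P) :
  infinite_set [set: N] -> kazhdan N -> ~ haagerup R G.
Proof.
move=> Ninf kN [H [pi [pi_rep [I [le [v [dir v1 vinv]]]] c0]]].
have valM (g h : N) : val (g * h)%g = (val g * val h)%g :> G by exact: valM.
have [w w0 winv] : exists2 w : H, w != 0 & forall n : N, pi (val n) w = w.
  apply: (kN H (fun n => pi (val n))).
    case: pi_rep => piU pi1 piM; split=> [n|x|n m x].
    - exact: piU.
    - by rewrite val1.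
    - by rewrite valM.
  by exists I, le, v; split=> // n; exact: vinv.
have ww : 0 < rdot w w.
  by rewrite lt_def rdot_ge0 andbT -rnorm_sq sqrf_eq0; apply: contra_neq w0 => /rnorm0_eq0.
have [E [finE Esmall]] := c0 w w _ ww.
have [n nE] : exists n : N, ~ E (val n).
  apply: contrapT => /forallNP NE; apply: Ninf.
  apply: (@sub_finite_set _ _ (val @^-1` E)) => [n _|].
    exact: contrapT (NE n).
  by apply: finite_preimage => // x y _ _; exact: val_inj.
have := Esmall _ nE; rewrite winv /rnorm.
have -> : inner H w w = (rdot w w)%:C.
  by rewrite -inner_normE normC -rmorphXn /= rnorm_sq.
rewrite ger0_norm ?lecR ?(ltW ww) //=.
by rewrite ltxx.
Qed.

End PropertyT.

(** * Square summable functions *)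

Section SquareModulus.
Variable R : realType.
Implicit Types z w : R[i].

Definition sqmod z : R := complex.Re z ^+ 2 + complex.Im z ^+ 2.

Lemma sqmod_ge0 z : 0 <= sqmod z.
Proof. by rewrite addr_ge0 // sqr_ge0. Qed.

Lemma sqmodM z w : sqmod (z * w) = sqmod z * sqmod w.
Proof. by case: z w => a b [c d]; rewrite /sqmod /=; ring. Qed.

Lemma sqmodD_le z w : sqmod (z + w) <= 2 * sqmod z + 2 * sqmod w.
Proof.
case: z w => a b [c d]; rewrite /sqmod /=.
have := sqr_ge0 (a - c); have := sqr_ge0 (b - d); rewrite !expr2; lra.
Qed.

Lemma sqmod_eq0 z : sqmod z = 0 -> z = 0.
Proof.
case: z => a b; rewrite /sqmod /= => /eqP.
by rewrite paddr_eq0 ?sqr_ge0 // !sqrf_eq0 => /andP[/eqP -> /eqP ->].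
Qed.

Lemma sqmodE z : sqmod z = rnorm z ^+ 2.
Proof. by rewrite /rnorm normc_def /= sqr_sqrtr // sqmod_ge0. Qed.

End SquareModulus.

Section SquareSummable.
Variables (R : realType) (T : countType).
Implicit Types (f g : T -> R[i]).

Definition square_summable : pred (T -> R[i]) :=
  fun f => `[< (\esum_(t in [set: T]) (sqmod (f t))%:E < +oo)%E >].

Lemma square_summableP f : reflect
  (exists c : R, forall s : seq T, uniq s -> \sum_(t <- s) sqmod (f t) <= c)
  (f \in square_summable).
Proof.
rewrite unfold_in; apply: (iffP (asboolP _)) => [foo|[c fc]].
  exists (fine (\esum_(t in [set: T]) (sqmod (f t))%:E)) => s us.
  have f0 : (0 <= \esum_(t in [set: T]) (sqmod (f t))%:E)%E.
    by apply: esum_ge0 => t _; rewrite lee_fin sqmod_ge0.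
  by rewrite -lee_fin fineK ?ge0_fin_numE //; exact: esum_ge_seq.
by apply: (@le_lt_trans _ _ c%:E); [apply: esum_le_seq => s /fc | rewrite ltry].
Qed.

Fact square_summable_submod : submod_closed square_summable.
Proof.
split.
  apply/square_summableP; exists 0 => s _.
  by rewrite big1 // => t _; rewrite /sqmod /= expr0n addr0.
move=> a f g /square_summableP[b fb] /square_summableP[c gc].
apply/square_summableP; exists (2 * (sqmod a * b) + 2 * c) => s us.
apply: (@le_trans _ _ (\sum_(t <- s)
    (2 * (sqmod a * sqmod (f t)) + 2 * sqmod (g t)))).
  by apply: ler_sum => t _; rewrite -sqmodM; exact: sqmodD_le.
rewrite big_split -!mulr_sumr lerD // ler_pM2l ?gc ?fb //.
by rewrite ler_wpM2l ?sqmod_ge0 ?fb.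
Qed.

HB.instance Definition _ := GRing.isSubmodClosed.Build R[i] (T -> R[i])
  square_summable square_summable_submod.

Record l2 := L2 { l2_fun :> T -> R[i]; _ : l2_fun \in square_summable }.

HB.instance Definition _ := [isSub for l2_fun].
HB.instance Definition _ := [Choice of l2 by <:].
HB.instance Definition _ := [SubChoice_isSubLmodule of l2 by <:].
End SquareSummable.

(** * The inner product of square summable functions *)

Section EnergyForm.
Variables (R : realType) (T : countType).
Local Notation l2 := (l2 R T).
Implicit Types (x y z : l2).

Lemma l2_eqP x y : (forall t, x t = y t) -> x = y.
Proof. by move=> xy; apply/val_inj/funext. Qed.

Lemma l2DE x y t : (x + y) t = x t + y t. Proof. by []. Qed.
Lemma l2NE x t : (- x) t = - x t. Proof. by []. Qed.
Lemma l2ZE (a : R[i]) x t : (a *: x) t = a * x t. Proof. by []. Qed.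
Lemma l20E t : (0 : l2) t = 0. Proof. by []. Qed.
Definition l2E := (l2DE, l2NE, l2ZE, l20E).

(** The extended sum is finite on square summable functions ([sumsqE]), so
    taking its real value loses nothing. *)
Definition sumsq x : R := fine (\esum_(t in [set: T]) (sqmod (x t))%:E).

Lemma sumsqE x : (sumsq x)%:E = \esum_(t in [set: T]) (sqmod (x t))%:E.
Proof.
rewrite fineK // ge0_fin_numE; first by have /asboolP := valP x.
by apply: esum_ge0 => t _; rewrite lee_fin sqmod_ge0.
Qed.

Lemma sumsq_ge x (s : seq T) : uniq s -> \sum_(t <- s) sqmod (x t) <= sumsq x.
Proof. by move=> us; rewrite -lee_fin sumsqE; exact: esum_ge_seq. Qed.

Lemma sumsq_le x (c : R) :
  (forall s : seq T, uniq s -> \sum_(t <- s) sqmod (x t) <= c) -> sumsq x <= c.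
Proof. by move=> xc; rewrite -lee_fin sumsqE; apply: esum_le_seq => s /xc. Qed.

Lemma sumsq_ge0 x : 0 <= sumsq x.
Proof. by have := @sumsq_ge x [::] isT; rewrite big_nil. Qed.

Lemma sumsq_ge1 x t : sqmod (x t) <= sumsq x.
Proof. by have := @sumsq_ge x [:: t] isT; rewrite big_seq1. Qed.

Lemma sumsq_eq0 x : sumsq x = 0 -> x = 0.
Proof.
move=> x0; apply: l2_eqP => t; apply: sqmod_eq0.
by apply/eqP; rewrite eq_le sqmod_ge0 -x0 sumsq_ge1.
Qed.

Lemma sumsqZ (a : R[i]) x : sumsq (a *: x) = sqmod a * sumsq x.
Proof.
suff le_sumsqZ (b : R[i]) y : sumsq (b *: y) <= sqmod b * sumsq y.
  apply/eqP; rewrite eq_le le_sumsqZ /=.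
  have [->|a0] := eqVneq a 0; first by rewrite {1}/sqmod /= expr0n addr0 mul0r sumsq_ge0.
  have := le_sumsqZ a^-1 (a *: x); rewrite scalerA mulVf // scale1r.
  move/(ler_wpM2l (sqmod_ge0 a)); rewrite mulrA -sqmodM mulfV //.
  by rewrite {2}/sqmod /= expr1n expr0n addr0 mul1r.
apply: sumsq_le => s us.
under eq_bigr do rewrite l2ZE sqmodM.
by rewrite -mulr_sumr ler_wpM2l ?sqmod_ge0 ?sumsq_ge.
Qed.

Lemma sumsqZr (a : R) x : sumsq (a%:C *: x) = a ^+ 2 * sumsq x.
Proof. by rewrite sumsqZ /sqmod /= [0 ^+ 2]expr0n addr0. Qed.

Lemma sumsqN x : sumsq (- x) = sumsq x.
Proof. by rewrite -scaleN1r sumsqZ /sqmod /= oppr0 expr0n addr0 sqrrN expr1n mul1r. Qed.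

Lemma sumsq0 : sumsq 0 = 0.
Proof. by rewrite -(scale0r (0 : l2)) sumsqZ /sqmod /= expr0n addr0 mul0r. Qed.

(** Every algebraic law of the inner product reduces to such a pointwise
    identity.  Since only series of nonnegative terms occur, linearity needs no
    discussion of absolute convergence. *)
Lemma sumsq_rel x1 x2 x3 y1 y2 y3 :
  (forall t, sqmod (x1 t) + sqmod (x2 t) + sqmod (x3 t) =
             sqmod (y1 t) + sqmod (y2 t) + sqmod (y3 t)) ->
  sumsq x1 + sumsq x2 + sumsq x3 = sumsq y1 + sumsq y2 + sumsq y3.
Proof.
move=> xy; apply: EFin_inj; rewrite !EFinD !sumsqE.
rewrite -!esumD; first by apply: eq_esum => t _; rewrite -!EFinD xy.
all: by move=> t _; rewrite ?adde_ge0 ?lee_fin ?sqmod_ge0.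
Qed.

(** Polarization; bilinearity is obtained from [sumsq_rel]. *)
Definition redot x y : R := (sumsq (x + y) - sumsq (x - y)) / 4.

Lemma redotC x y : redot x y = redot y x.
Proof. by rewrite /redot (addrC x) -(sumsqN (x - y)) opprB. Qed.

Lemma redotNl x y : redot (- x) y = - redot x y.
Proof.
rewrite /redot -(sumsqN (- x + y)) -(sumsqN (- x - y)) !opprD !opprK.
by rewrite -mulNr opprB.
Qed.

Lemma redotNr x y : redot x (- y) = - redot x y.
Proof. by rewrite redotC redotNl redotC. Qed.

Lemma redotDl x y z : redot (x + y) z = redot x z + redot y z.
Proof.
have : sumsq (x + y + z) + sumsq (x - z) + sumsq (y - z) =
       sumsq (x + y - z) + sumsq (x + z) + sumsq (y + z).
  apply: sumsq_rel => t; rewrite !l2E.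
  by case: (x t) (y t) (z t) => a b [c d] [k l]; rewrite /sqmod /=; ring.
rewrite /redot; lra.
Qed.

Lemma redotZl (a : R) x y : redot (a%:C *: x) y = a * redot x y.
Proof.
wlog a0 : a / 0 <= a => [H|].
  have [/H//|a0] := leP 0 a.
  have := H (- a); rewrite oppr_ge0 => /(_ (ltW a0)).
  by rewrite rmorphN /= scaleNr redotNl mulNr => /oppr_inj.
(* The scalar [a] is absorbed in the squares through its square root. *)
pose s := (Num.sqrt a)%:C : R[i].
have : sumsq (a%:C *: x + y) + sumsq (s *: (x - y)) + sumsq 0 =
       sumsq (a%:C *: x - y) + sumsq (s *: (x + y)) + sumsq 0.
  apply: sumsq_rel => t; rewrite !l2E !sqmodM.
  have -> : sqmod s = a by rewrite /sqmod /= sqr_sqrtr // [0 ^+ 2]expr0n addr0.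
  by case: (x t) (y t) => b c [d k]; rewrite /sqmod /=; ring.
rewrite !sumsqZr sqr_sqrtr // /redot; lra.
Qed.

Lemma redotZr (a : R) x y : redot x (a%:C *: y) = a * redot x y.
Proof. by rewrite redotC redotZl redotC. Qed.

Lemma redotDr x y z : redot x (y + z) = redot x y + redot x z.
Proof. by rewrite redotC redotDl !(redotC x). Qed.

Lemma redotxx x : redot x x = sumsq x.
Proof.
rewrite /redot subrr sumsq0 subr0.
have -> : x + x = 2%:C *: x :> l2.
  apply: l2_eqP => t; rewrite !l2E; case: (x t) => a b; simpc.
  by congr (_ +i* _); ring.
by rewrite sumsqZr; lra.
Qed.

Lemma redot_iMM x y : redot ('i%C *: x) ('i%C *: y) = redot x y.
Proof.
rewrite /redot -scalerDr -scalerBr !sumsqZ.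
have -> : sqmod ('i%C : R[i]) = 1 by rewrite /sqmod /= expr0n expr1n add0r.
by rewrite !mul1r.
Qed.

Let scaleii x : 'i%C *: ('i%C *: x) = - x :> l2.
Proof. by rewrite scalerA -expr2 sqr_i scaleN1r. Qed.

Lemma redot_imr x y : redot ('i%C *: x) y = - redot x ('i%C *: y).
Proof. by rewrite -redot_iMM scaleii redotNl. Qed.

(** The imaginary part of [<x, y>] is the real part of [<x, i y>], as the inner
    product is conjugate-linear in its second argument. *)
Definition l2dot x y : R[i] := redot x y +i* redot x ('i%C *: y).

Lemma sumsqD x y : sumsq (x + y) = sumsq x + sumsq y + 2 * redot x y.
Proof. by rewrite -!redotxx redotDl !redotDr (redotC y); ring. Qed.

Lemma redot_CS x y : redot x y <= Num.sqrt (sumsq x) * Num.sqrt (sumsq y).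
Proof.
rewrite -sqrtrM ?sumsq_ge0 //; apply: (le_trans (ler_norm _)).
rewrite -sqrtr_sqr ler_wsqrtr //.
have [y0|y0] := eqVneq (sumsq y) 0.
  rewrite (sumsq_eq0 y0) -(scale0r y) (redotZr 0) mul0r expr0n.
  by rewrite mulr_ge0 ?sumsq_ge0.
have ypos : 0 < sumsq y by rewrite lt_def y0 sumsq_ge0.
have := sumsq_ge0 ((sumsq y)%:C *: x - (redot x y)%:C *: y).
rewrite sumsqD sumsqN !sumsqZr redotNr redotZl redotZr.
have -> : sumsq y ^+ 2 * sumsq x + redot x y ^+ 2 * sumsq y +
   2 * - (sumsq y * (redot x y * redot x y)) =
   sumsq y * (sumsq x * sumsq y - redot x y ^+ 2) by ring.
by rewrite pmulr_rge0 // subr_ge0.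
Qed.

Lemma sqrt_sumsq_triangle x y :
  Num.sqrt (sumsq (x + y)) <= Num.sqrt (sumsq x) + Num.sqrt (sumsq y).
Proof.
have nn : 0 <= Num.sqrt (sumsq x) + Num.sqrt (sumsq y) by rewrite addr_ge0 ?sqrtr_ge0.
rewrite -[leRHS]ger0_norm // -sqrtr_sqr ler_wsqrtr //.
rewrite sumsqD sqrrD !sqr_sqrtr ?sumsq_ge0 //.
by have := redot_CS x y; lra.
Qed.

Definition l2norm x : R[i] := (Num.sqrt (sumsq x))%:C.

Fact l2norm_triangle x y : l2norm (x + y) <= l2norm x + l2norm y.
Proof. by rewrite /l2norm -rmorphD /= lecR sqrt_sumsq_triangle. Qed.

Fact l2normZ (a : R[i]) x : l2norm (a *: x) = `|a| * l2norm x.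
Proof.
rewrite /l2norm sumsqZ sqrtrM ?sqmod_ge0 // rmorphM /=; congr (_ * _).
by rewrite sqmodE sqrtr_sqr ger0_norm ?rnorm_ge0 // normC.
Qed.

Fact l2norm0_eq0 x : l2norm x = 0 -> x = 0.
Proof.
case=> /eqP; rewrite sqrtr_eq0 => x0.
by apply: sumsq_eq0; apply/eqP; rewrite eq_le x0 sumsq_ge0.
Qed.

HB.instance Definition _ := Lmodule_isNormed.Build R[i] l2
  l2norm_triangle l2normZ l2norm0_eq0.

Lemma l2_rnormE x : rnorm x = Num.sqrt (sumsq x).
Proof. by []. Qed.

Fact l2dot_zmodl y : zmod_morphism (l2dot^~ y).
Proof.
by move=> x z; rewrite /l2dot !redotDl !redotNl; simpc.
Qed.

Fact l2dotC x y : l2dot x y = (-1) ^+ false * Num.conj (l2dot y x).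
Proof.
rewrite expr0 mul1r /l2dot; congr (_ +i* _); first exact: redotC.
by rewrite redotC redot_imr.
Qed.

Fact l2dot_zmodr x : zmod_morphism (l2dot x).
Proof.
move=> y z; rewrite /l2dot scalerBr !redotDr !redotNr; simpc.
by [].
Qed.

Let splitC (a : R[i]) x : a *: x = (complex.Re a)%:C *: x +
  (complex.Im a)%:C *: ('i%C *: x).
Proof.
rewrite scalerA -scalerDl; congr (_ *: _); case: a => a b; simpc.
by [].
Qed.

Fact l2dot_scalel y : scalable_for ( *%R ) (l2dot^~ y).
Proof.
move=> a x; rewrite splitC /l2dot !redotDl !redotZl !redot_imr scaleii redotNr.
by case: a => a b; simpc; congr (_ +i* _); ring.
Qed.

Fact l2dot_scaler x : scalable_for (Num.conj \; *%R) (l2dot x).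
Proof.
move=> a y; rewrite l2dotC l2dot_scalel /= rmorphM expr0 !mul1r.
by rewrite [in RHS]l2dotC expr0 mul1r.
Qed.

HB.instance Definition _ := isBilinear.Build R[i] l2 l2 R[i] ( *%R )
  (Num.conj \; *%R) l2dot l2dot_zmodl l2dot_zmodr l2dot_scalel l2dot_scaler.
HB.instance Definition _ :=
  isHermitianSesquilinear.Build R[i] l2 false Num.conj l2dot l2dotC.

Lemma l2dotxx x : l2dot x x = (sumsq x)%:C.
Proof.
rewrite /l2dot redotxx; congr (_ +i* _).
have : redot x ('i%C *: x) = - redot x ('i%C *: x).
  by rewrite {1}redotC redot_imr.
lra.
Qed.

Fact l2dot_gt0 x : x != 0 -> 0 < l2dot x x.
Proof.
move=> x0; rewrite l2dotxx ltcR lt_def sumsq_ge0 andbT.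
by apply: contra_neq x0 => /sumsq_eq0.
Qed.

HB.instance Definition _ := isDotProduct.Build R[i] l2 l2dot l2dot_gt0.

Fact l2dot_normE x : `|x| ^+ 2 = l2dot x x.
Proof. by rewrite l2dotxx /Num.norm /= /l2norm -rmorphXn /= sqr_sqrtr ?sumsq_ge0. Qed.

End EnergyForm.

(** * Completeness and separability of the space of square summable functions *)

Section L2Hilbert.
Variables (R : realType) (T : countType).
Local Notation l2 := (l2 R T).
Implicit Types (x y : l2).

Lemma sum_subset_uniq (f : T -> R) (s r : seq T) : (forall t, 0 <= f t) ->
  uniq s -> uniq r -> {subset s <= r} -> \sum_(t <- s) f t <= \sum_(t <- r) f t.
Proof.
move=> f0 us ur sr.
have rs : perm_eq [seq t <- r | t \in s] s.
  apply: uniq_perm; rewrite ?filter_uniq // => t.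
  by rewrite mem_filter; case: (boolP (t \in s)) => //= /sr ->.
rewrite [leRHS](bigID (fun t => t \in s)) /= -[X in _ <= X + _]big_filter.
rewrite (perm_big _ rs) lerDl.
exact: sumr_ge0.
Qed.

Lemma l2_ball x (e : R) y : ball x e%:C y <-> rnorm (x - y) < e.
Proof. by rewrite -ball_normE /= normC ltcR. Qed.

Lemma sumsq_lt x (e : R) : 0 < e -> sumsq x < e ^+ 2 -> rnorm x < e.
Proof.
move=> e0 xe; rewrite l2_rnormE -[ltRHS]ger0_norm ?(ltW e0) // -sqrtr_sqr.
by rewrite ltr_sqrt // exprn_gt0.
Qed.

Lemma sumsq_rnorm x : sumsq x = rnorm x ^+ 2.
Proof. by rewrite l2_rnormE sqr_sqrtr // sumsq_ge0. Qed.

(** Along a Cauchy filter every coordinate converges.  A point [x] of a small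
    set of the filter is close to all other points of it, in particular every
    finite partial sum of squared differences is small, and this bound on
    finite sums passes to the coordinatewise limit. *)
Lemma l2_complete (F : set_system l2) : ProperFilter F -> cauchy F -> cvg F.
Proof.
move=> FF /cauchyP Fc.
have {}Fc (e : R) : 0 < e -> exists x, F [set y | rnorm (x - y) < e].
  move=> e0; have [|x Fx] := Fc e%:C; first by rewrite ltcR.
  by exists x; apply: filterS Fx => y /l2_ball.
have part_le (p : R[i] -> R) : (forall z, p z ^+ 2 <= sqmod z) ->
    forall x t, `|p (x t)| <= rnorm x.
  move=> psq x t; rewrite l2_rnormE -sqrtr_sqr ler_wsqrtr //.
  by apply: le_trans (psq _) _; exact: sumsq_ge1.
have Fpart (p : R[i] -> R) : (forall z, p z ^+ 2 <= sqmod z) ->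
    (forall z w, p (z - w) = p z - p w) ->
    forall t, cvg (p ((y : l2) t) @[y --> F]).
  move=> psq pB t; apply: cauchy_cvg; apply: cauchy_exP => e e0.
  have [x Fx] := Fc _ e0; exists (p (x t)).
  suff : F [set y : l2 | ball (p (x t)) e (p (y t))] by [].
  apply: filterS Fx => y /= xy.
  by rewrite -ball_normE /= -pB (le_lt_trans _ xy) // -[x t - y t]/((x - y) t) part_le.
have Fre t : cvg (complex.Re ((y : l2) t) @[y --> F]).
  apply: (Fpart (@complex.Re R)) => [z|[? ?] []//].
  by rewrite lerDl sqr_ge0.
have Fim t : cvg (complex.Im ((y : l2) t) @[y --> F]).
  apply: (Fpart (@complex.Im R)) => [z|[? ?] []//].
  by rewrite lerDr sqr_ge0.
pose f t : R[i] :=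
  lim (complex.Re ((y : l2) t) @[y --> F]) +i* lim (complex.Im ((y : l2) t) @[y --> F]).
have sum_cvg x (s : seq T) :
    \sum_(t <- s) sqmod (x t - (y : l2) t) @[y --> F] --> \sum_(t <- s) sqmod (x t - f t).
  elim: s => [|t s IHs].
    by rewrite big_nil; under eq_cvg do rewrite big_nil; exact: cvg_cst.
  rewrite big_cons; under eq_cvg do rewrite big_cons.
  apply: cvgD => //; rewrite /sqmod.
  have dif (p : R[i] -> R) l : p ((y : l2) t) @[y --> F] --> l ->
      (p (x t) - p ((y : l2) t)) ^+ 2 @[y --> F] --> (p (x t) - l) ^+ 2.
    move=> pl; have c : p (x t) - p ((y : l2) t) @[y --> F] --> p (x t) - l.
      by apply: cvgB => //; exact: cvg_cst.
    by rewrite expr2; under eq_cvg do rewrite expr2; exact: cvgM.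
  have reB (z w : R[i]) : complex.Re (z - w) = complex.Re z - complex.Re w.
    by case: z w => ? ? [].
  have imB (z w : R[i]) : complex.Im (z - w) = complex.Im z - complex.Im w.
    by case: z w => ? ? [].
  rewrite reB imB; under eq_cvg do rewrite reB imB.
  apply: cvgD.
    by apply: (dif (@complex.Re R)); exact: Fre.
  by apply: (dif (@complex.Im R)); exact: Fim.
have near_f (e : R) : 0 < e -> F [set x | forall s, uniq s ->
    \sum_(t <- s) sqmod (x t - f t) <= e ^+ 2].
  move=> e0; have [|z Fz] := Fc (e / 2); first by rewrite divr_gt0.
  apply: filterS (Fz) => x /= zx s us.
  apply: (cvgr_to_le (sum_cvg x s)); apply: filterS Fz => y /= zy.
  have xy : rnorm (x - y) <= e.
    have -> : x - y = (z - y) - (z - x) by rewrite opprB [RHS]addrC addrA subrK.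
    apply: (le_trans (rnorm_triangle _ _)); rewrite rnormN; lra.
  apply: (@le_trans _ _ (sumsq (x - y))); first exact: (sumsq_ge (x - y)).
  by rewrite sumsq_rnorm lerXn2r ?nnegrE ?rnorm_ge0 ?(ltW e0).
have f2 : f \in @square_summable R T.
  have [x xf] := filter_ex (near_f 1 ltr01).
  have -> : f = (x : T -> R[i]) - ((x : T -> R[i]) - f) by rewrite opprB addrC subrK.
  rewrite rpredB ?(valP x) //.
  by apply/square_summableP; exists (1 ^+ 2) => s /xf.
apply/cvg_ex; exists (L2 f2).
apply/cvg_ballP => _ /posC_real[r r0 ->].
have r20 : 0 < r / 2 by rewrite divr_gt0.
apply: filterS (near_f _ r20) => x xf; apply/l2_ball.
rewrite rnormB; apply: (@le_lt_trans _ _ (r / 2)); last by lra.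
rewrite l2_rnormE -[leRHS]ger0_norm ?(ltW r20) // -sqrtr_sqr ler_wsqrtr //.
exact: sumsq_le.
Qed.

HB.instance Definition _ := Uniform_isComplete.Build l2 l2_complete.

Lemma finite_support_square_summable (f : T -> R[i]) (r : seq T) :
  (forall t, t \notin r -> f t = 0) -> f \in @square_summable R T.
Proof.
move=> fr; apply/square_summableP; exists (\sum_(t <- undup r) sqmod (f t)) => s us.
rewrite (bigID (mem r)) /= [X in _ + X]big1 ?addr0; last first.
  by move=> t /fr ->; rewrite /sqmod /= expr0n addr0.
rewrite -big_filter sum_subset_uniq ?filter_uniq ?undup_uniq //.
  by move=> t; exact: sqmod_ge0.
by move=> t; rewrite mem_filter mem_undup => /andP[].
Qed.

(** Finitely supported functions with rational coordinates, coded by finite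
    lists of values to make countability immediate. *)
Definition rat_step (l : seq (T * (rat * rat))) (t : T) : R[i] :=
  if t \in unzip1 l then
    let c := (nth (t, (0, 0)) l (index t (unzip1 l))).2 in
    ratr c.1 +i* ratr c.2
  else 0.

Lemma rat_step_square_summable l : rat_step l \in @square_summable R T.
Proof.
apply: (@finite_support_square_summable _ (unzip1 l)) => t tl.
by rewrite /rat_step (negPf tl).
Qed.

Lemma complex_rat_approx (z : R[i]) (e : R) : 0 < e ->
  exists c : rat * rat, sqmod (z - (ratr c.1 +i* ratr c.2)) < e.
Proof.
move=> e0; case: z => a b.
have d0 : 0 < Num.sqrt (e / 2) by rewrite sqrtr_gt0 divr_gt0.
have approx (u : R) : exists c : rat, (u - ratr c) ^+ 2 < e / 2.
  have [|c] := @rat_in_itvoo R (u - Num.sqrt (e / 2)) (u + Num.sqrt (e / 2)).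
    by rewrite ltrD2l gtrN.
  rewrite in_itv /= => /andP[c1 c2]; exists c.
  rewrite -[ltRHS]sqr_sqrtr ?divr_ge0 ?(ltW e0) // -real_normK ?num_real //.
  by rewrite ltrXn2r ?nnegrE ?sqrtr_ge0 // ltr_norml; apply/andP; split; lra.
have [c1 h1] := approx a; have [c2 h2] := approx b.
by exists (c1, c2); rewrite /sqmod /=; lra.
Qed.

Lemma sumsq_approx x (e : R) : 0 < e ->
  exists l, sumsq (x - L2 (rat_step_square_summable l)) < e.
Proof.
move=> e0; have e20 : 0 < e / 2 by rewrite divr_gt0.
have [s us xs] : exists2 s : seq T, uniq s &
    sumsq x - e / 2 < \sum_(t <- s) sqmod (x t).
  apply: contrapT => ns; suff : sumsq x <= sumsq x - e / 2 by lra.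
  apply: sumsq_le => s us; rewrite leNgt; apply/negP => xs.
  by apply: ns; exists s.
pose d := e / 2 / (size s).+1%:R.
have d0 : 0 < d by rewrite divr_gt0 ?ltr0n.
have [c cP] := choice (fun t => complex_rat_approx (x t) d0).
pose l := [seq (t, c t) | t <- s].
have l1 : unzip1 l = s by rewrite /unzip1 -map_comp map_id.
have stepE t : rat_step l t = if t \in s then ratr (c t).1 +i* ratr (c t).2 else 0.
  rewrite /rat_step l1; case: ifP => // ts.
  by rewrite (nth_map t) ?index_mem // nth_index.
exists l.
apply: (@le_lt_trans _ _ (sumsq x - \sum_(t <- s) sqmod (x t) + (size s)%:R * d)).
  apply: sumsq_le => r ur; rewrite (bigID (fun t => t \in s)) /= addrC lerD //.
    rewrite lerBrDl [X in _ + X](eq_bigr (fun t => sqmod (x t))); last first.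
      by move=> t /negPf ts; rewrite -[LHS]/(sqmod (x t - rat_step l t)) stepE ts subr0.
    rewrite -[X in _ + X]big_filter -big_cat sumsq_ge // cat_uniq us filter_uniq // andbT.
    by apply/hasPn => t; rewrite mem_filter => /andP[].
  rewrite -big_filter.
  apply: (@le_trans _ _ (\sum_(t <- s) sqmod ((x - L2 (rat_step_square_summable l)) t))).
    apply: sum_subset_uniq; rewrite ?filter_uniq // => t.
      exact: sqmod_ge0.
    by rewrite mem_filter => /andP[].
  apply: (@le_trans _ _ (\sum_(t <- s) d)).
    rewrite big_seq [leRHS]big_seq; apply: ler_sum => t ts.
    by rewrite -[leLHS]/(sqmod (x t - rat_step l t)) stepE ts ltW.
  by rewrite big_const_seq count_predT iter_addr addr0 mulr_natl.
have : (size s)%:R * d <= e / 2.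
  rewrite /d mulrCA ler_piMr ?(ltW e20) // ler_pdivrMr ?ltr0n // mul1r ler_nat.
  exact: leqnSn.
lra.
Qed.

Lemma l2_separable : exists D : set l2, countable D /\ dense D.
Proof.
exists (range (fun l => L2 (rat_step_square_summable l))); split.
  by apply: (sub_countable (card_image_le _ _)); exact: countableP.
move=> O [x Ox] Oop.
have /nbhs_ballP[_ /= /posC_real[r r0 ->] xO] := open_nbhs_nbhs (conj Oop Ox).
have [l xl] := sumsq_approx x (exprn_gt0 2 r0).
exists (L2 (rat_step_square_summable l)); split; last by exists l.
by apply: xO; apply/l2_ball; exact: sumsq_lt.
Qed.

Definition l2_hilbert : hilbertSpace R :=
  @HilbertSpace R l2 (@l2dot R T) (@l2dot_normE R T) l2_separable.

End L2Hilbert.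

(** * Translations and indicators *)

Lemma countably_infiniteI (T : Type) (A : set T) (f : nat -> T) :
  countable A -> injective f -> (forall n, A (f n)) -> countably_infinite A.
Proof.
move=> cA finj fA; apply: eq_card_nat => //.
apply/infiniteP; apply: (@card_le_trans _ _ _ (range f)).
  by have /card_eqPle[] := @inj_card_eq _ _ [set: nat] f (in2W finj).
by apply: subset_card_le => _ [n _ <-].
Qed.


Section Translation.
Variables (R : realType) (V : countZmodType).
Local Notation l2 := (l2 R V).
Implicit Types (x y : l2) (u t : V).

Fact translate_square_summable u x :
  (fun t => x (t - u)) \in @square_summable R V.
Proof.
apply/square_summableP; exists (sumsq x) => s us.
rewrite -(big_map (fun t => t - u) predT (fun t => sqmod (x t))).
by apply: sumsq_ge; rewrite map_inj_uniq //; exact: addIr.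
Qed.

Definition translate u x : l2 := L2 (translate_square_summable u x).

Lemma translate0 x : translate 0 x = x.
Proof. by apply: l2_eqP => t /=; rewrite subr0. Qed.

Lemma translateD u w x : translate (u + w) x = translate u (translate w x).
Proof. by apply: l2_eqP => t /=; rewrite opprD addrA. Qed.

Lemma translate_linear u : linear (translate u).
Proof. by move=> a x y; exact: l2_eqP. Qed.

Lemma sumsq_translate u x : sumsq (translate u x) = sumsq x.
Proof.
suff le w y : sumsq (translate w y) <= sumsq y.
  apply/eqP; rewrite eq_le le -{1}[x](translate0 x) -(addNr u) translateD.
  exact: le.
apply: sumsq_le => s us.
rewrite -(big_map (fun t => t - w) predT (fun t => sqmod (y t))).
by apply: sumsq_ge; rewrite map_inj_uniq //; exact: addIr.
Qed.

Lemma translate_l2dot u x y : l2dot (translate u x) (translate u y) = l2dot x y.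
Proof.
have redot_tr z w : redot (translate u z) (translate u w) = redot z w.
  have trD : translate u z + translate u w = translate u (z + w) by exact: l2_eqP.
  have trB : translate u z - translate u w = translate u (z - w) by exact: l2_eqP.
  by rewrite /redot trD trB !sumsq_translate.
rewrite /l2dot; have -> : 'i%C *: translate u y = translate u ('i%C *: y).
  exact: l2_eqP.
by rewrite !redot_tr.
Qed.

End Translation.

Section Indicator.
Variables (R : realType) (T : countType).
Local Notation l2 := (l2 R T).

Fact indicator_square_summable (A : seq T) :
  (fun t => (t \in A)%:R : R[i]) \in @square_summable R T.
Proof.
by apply: (@finite_support_square_summable _ _ _ A) => t /negPf ->.
Qed.

Definition indicator (A : seq T) : l2 := L2 (indicator_square_summable A).

Lemma sumsq_indicator (A : seq T) : uniq A -> sumsq (indicator A) = (size A)%:R.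
Proof.
have nA t : sqmod (indicator A t) = if t \in A then 1 else 0.
  by rewrite /= /sqmod; case: (t \in A); rewrite /= ?expr1n expr0n ?addr0.
move=> uA; apply/eqP; rewrite eq_le; apply/andP; split.
  apply: sumsq_le => s us; rewrite (eq_bigr _ (fun t _ => nA t)) -big_mkcond.
  rewrite -big_filter big_const_seq count_predT iter_addr addr0 ler_nat.
  apply: uniq_leq_size; first exact: filter_uniq.
  by move=> t; rewrite mem_filter => /andP[].
apply: le_trans (sumsq_ge (indicator A) uA); rewrite (eq_bigr _ (fun t _ => nA t)).
rewrite big_seq (eq_bigr (fun=> 1)) => [|t ->//].
by rewrite -big_seq big_const_seq count_predT iter_addr addr0.
Qed.

Lemma l2dot_indicator1 (x : l2) (t : T) : l2dot x (indicator [:: t]) = x t.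
Proof.
have redotZ z : redot x (z *: indicator [:: t]) =
    complex.Re (x t) * complex.Re z + complex.Im (x t) * complex.Im z.
  have : sumsq (x + z *: indicator [:: t]) +
      sumsq ((x t - z) *: indicator [:: t]) + sumsq (0 : l2) =
      sumsq (x - z *: indicator [:: t]) +
      sumsq ((x t + z) *: indicator [:: t]) + sumsq (0 : l2).
    apply: sumsq_rel => t'; rewrite !l2E /= inE.
    case: eqP => [->|_]; rewrite ?mulr1 ?mulr0 ?subr0 ?addr0.
      by congr (_ + _); rewrite addrC.
    by [].
  rewrite !sumsqZ sumsq_indicator // mulr1 sumsq0 /redot.
  by case: (x t) z => a b [c d]; rewrite /sqmod /= !expr2; lra.
rewrite /l2dot -[in X in X +i* _](scale1r (indicator _)) !redotZ /=.
by case: (x t) => a b /=; rewrite !mulr0 !mulr1 addr0 add0r.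
Qed.

End Indicator.

(** * Framenability from a locally finite quotient *)

Section LocallyFiniteQuotient.
Variables (R : realType) (G : groupType) (V : countZmodType).
Variables (p : G -> V) (s : V -> G) (A : nat -> seq V) (f : nat -> V).
Hypotheses (pM : forall g h, p (g * h)%g = p g + p h).
Hypotheses (sK : cancel s p) (f_inj : injective f).
Hypotheses (A_uniq : forall n, uniq (A n)) (A_neq0 : forall n, (0 < size (A n))%N).
Hypothesis A_invariant : forall u, exists n, forall m, (n <= m)%N ->
  forall t, (t - u \in A m) = (t \in A m).

Let H := l2_hilbert R V.
Let pi (g : G) : H -> H := @translate R V (p g).

Let pi_rep : unitary_rep pi.
Proof.
have p1 : p 1%g = 0 by apply: (addrI (p 1%g)); rewrite -pM mulg1 addr0.
split=> [g|x|g h x]; [split| |].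
- exact: translate_linear.
- move=> y; exists (translate (- p g) y).
  by rewrite /pi -translateD subrr translate0.
- exact: translate_l2dot.
- by rewrite /pi p1 translate0.
- by rewrite /pi pM translateD.
Qed.

Let pi_trivial : weakly_contains_trivial pi.
Proof.
pose c n : R := (Num.sqrt (size (A n))%:R)^-1.
exists nat, (fun m n => (m <= n)%N : Prop), (fun n => (c n)%:C *: indicator R (A n)).
split.
- split=> [|//|i j k|i j]; first by exists; exact: 0%N.
    exact: leq_trans.
  by exists (maxn i j); rewrite leq_maxl leq_maxr.
- move=> n; have A0 : 0 < (size (A n))%:R :> R by rewrite ltr0n.
  rewrite l2_rnormE sumsqZr sumsq_indicator // /c exprVn sqr_sqrtr ?(ltW A0) //.
  by rewrite mulVf ?sqrtr1 // gt_eqF.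
move=> g; have [n nA] := A_invariant (p g).
have fil : Filter (tails (fun m n : nat => (m <= n)%N : Prop)).
  apply: filter_from_filter; first by exists 0%N.
  move=> i j _ _; exists (maxn i j) => // k /=.
  by rewrite geq_max => /andP[].
apply: cvg_near_cst; exists n => // m /= nm.
have -> : pi g ((c m)%:C *: indicator R (A m)) = (c m)%:C *: indicator R (A m).
  rewrite /pi (scalable_linear (translate_linear _)); congr (_ *: _).
  by apply: l2_eqP => t /=; rewrite nA.
by rewrite subrr rnorm0.
Qed.


(** The sets [A n] are finite and eventually invariant under any given
    translation, so the net of their normalized indicators is eventually
    constant along each group element. *)
Lemma framenable_of_locally_finite_quotient : framenable R G.
Proof.
exists H, pi; split=> //; exists (range s), (indicator R [:: 0]); split.
  apply: (@countably_infiniteI _ _ (s \o f)).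
  - by apply: (sub_countable (card_image_le _ _)); exact: countableP.
  - exact: inj_comp (can_inj sK) f_inj.
  - by move=> n; exists (f n).
move=> x x0.
have coef u : rnorm (inner H x (pi (s u) (indicator R [:: 0]))) ^+ 2 = sqmod (x u).
  have -> : pi (s u) (indicator R [:: 0]) = indicator R [:: u].
    by apply: l2_eqP => t; rewrite /pi sK /= !inE subr_eq0.
  by rewrite -sqmodE /= l2dot_indicator1.
rewrite esum_image; last by move=> u w _ _; exact: (can_inj sK).
rewrite (eq_esum (b := fun u => (sqmod ((x : l2 R V) u))%:E)); last first.
  by move=> u _ /=; rewrite coef.
rewrite -sumsqE ltry andbT lte_fin lt_def sumsq_ge0 andbT.
by apply: contra_neq x0; exact: sumsq_eq0.
Qed.

End LocallyFiniteQuotient.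

(** * Generated subgroups, groups of units, elementary matrices *)

Section Generated.
Variables (G : groupType) (X : set G).
Local Open Scope group_scope.

(** Intersection of the subgroups containing [X]. *)
Definition generated : set G := [set g | forall S : set G, S 1 ->
  (forall a b, S a -> S b -> S (a * b)) -> (forall a, S a -> S a^-1) ->
  X `<=` S -> S g].

Lemma generatedM a b : generated a -> generated b -> generated (a * b).
Proof.
move=> ga gb S S1 SM SV XS.
by apply: (SM); [exact: ga|exact: gb].
Qed.

Lemma generatedV a : generated a -> generated a^-1.
Proof. by move=> ga S S1 SM SV XS; apply: (SV); exact: ga. Qed.

Lemma sub_generated : X `<=` generated.
Proof. by move=> a Xa S _ _ _; exact. Qed.

Lemma generated_commutator a b c : a * b = b * a * c ->
  generated a -> generated b -> generated c.
Proof.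
move=> abc ga gb; have -> : c = (b * a)^-1 * (a * b) by rewrite abc mulKg.
by apply: generatedM; [apply: generatedV|]; exact: generatedM.
Qed.

Definition generated_pred : pred G := fun g => `[< generated g >].

Lemma generated_predP g : reflect (generated g) (g \in generated_pred).
Proof. exact: asboolP. Qed.

Lemma generated_group_closed : group_closed generated_pred.
Proof.
split; first by apply/generated_predP.
move=> a b /generated_predP ga /generated_predP gb; apply/generated_predP.
by apply: generatedM => //; exact: generatedV.
Qed.

Record generated_subgroup := GeneratedSubgroup {
  generated_val :> G; _ : generated_pred generated_val }.

HB.instance Definition _ := [isSub for generated_val].
HB.instance Definition _ := [Choice of generated_subgroup by <:].
HB.instance Definition _ := SubChoice_isSubGroup.Build G generated_pred
  generated_subgroup generated_group_closed.

Lemma generated_subgroupP (g : generated_subgroup) : generated (val g).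
Proof. exact/generated_predP/(valP g). Qed.

Definition to_generated (g : G) (gX : generated g) : generated_subgroup :=
  GeneratedSubgroup (introT (generated_predP _) gX).

Lemma generated_subgroup_ind (S : generated_subgroup -> Prop) :
  S 1 -> (forall a b, S a -> S b -> S (a * b)) -> (forall a, S a -> S a^-1) ->
  (forall g, X (val g) -> S g) -> forall g, S g.
Proof.
move=> S1 SM SV SX g.
pose S' : set G := [set a | exists2 h : generated_subgroup, val h = a & S h].
have [h /val_inj <- //] : S' (val g).
apply: (generated_subgroupP g).
- by exists 1.
- by move=> _ _ [a <- Sa] [b <- Sb]; exists (a * b); [rewrite valM|exact: SM].
- by move=> _ [a <- Sa]; exists a^-1; [rewrite gmulfV|exact: SV].
- move=> a Xa; exists (to_generated (sub_generated Xa)) => //; exact: SX.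
Qed.

End Generated.

Section Units.
Variable A : unitRingType.

Record units := Units { units_val :> A; _ : units_val \is a GRing.unit }.

HB.instance Definition _ := [isSub for units_val].
HB.instance Definition _ := [Choice of units by <:].

Fact units_mul_subproof (a b : units) : val a * val b \is a GRing.unit.
Proof. by rewrite rpredM ?(valP a) ?(valP b). Qed.
Let mulu (a b : units) : units := Units (units_mul_subproof a b).
Let oneu : units := Units (unitr1 A).
Fact units_inv_subproof (a : units) : (val a)^-1 \is a GRing.unit.
Proof. by rewrite unitrV (valP a). Qed.
Let invu (a : units) : units := Units (units_inv_subproof a).

Fact units_mulA : associative mulu.
Proof. by move=> a b c; apply/val_inj; rewrite /= mulrA. Qed.
Fact units_mul1 : left_id oneu mulu.
Proof. by move=> a; apply/val_inj; rewrite /= mul1r. Qed.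
Fact units_mulV : left_inverse oneu invu mulu.
Proof. by move=> a; apply/val_inj; rewrite /= mulVr // (valP a). Qed.
Fact units_mulg1 : right_id oneu mulu.
Proof. by move=> a; apply/val_inj; rewrite /= mulr1. Qed.
Fact units_mulgV : right_inverse oneu invu mulu.
Proof. by move=> a; apply/val_inj; rewrite /= mulrV // (valP a). Qed.

HB.instance Definition _ := isGroup.Build units
  units_mulA units_mul1 units_mulg1 units_mulV units_mulgV.

End Units.

Lemma units_valM (A : unitRingType) (a b : units A) :
  val (a * b)%g = val a * val b.
Proof. by []. Qed.

Section Elementary.
Variables (A : comUnitRingType) (n : nat).
Local Notation M := 'M[A]_n.+1.
Implicit Types (i j k l : 'I_n.+1) (a b : A).

Definition elemmx i j a : M := 1 + a *: delta_mx i j.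

Lemma elemmx0 i j : elemmx i j 0 = 1.
Proof. by rewrite /elemmx scale0r addr0. Qed.

Let delta_mul i j k l a b : a *: delta_mx i j * (b *: delta_mx k l) =
  if j == k then (a * b) *: delta_mx i l else 0 :> M.
Proof.
rewrite -[LHS]/(_ *m _) -scalemxAl -scalemxAr scalerA.
by have [->|jk] := eqVneq j k; rewrite ?mul_delta_mx // mul_delta_mx_0 ?scaler0.
Qed.

Lemma elemmxM i j k l a b : elemmx i j a * elemmx k l b =
  1 + a *: delta_mx i j + b *: delta_mx k l +
  (if j == k then (a * b) *: delta_mx i l else 0).
Proof.
by rewrite /elemmx mulrDr mulr1 mulrDl mul1r delta_mul addrA.
Qed.

Lemma elemmxD i j a b : i != j -> elemmx i j (a + b) = elemmx i j a * elemmx i j b.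
Proof.
by move=> ij; rewrite elemmxM eq_sym (negPf ij) addr0 /elemmx scalerDl addrA.
Qed.

Lemma elemmx_unit i j a : i != j -> elemmx i j a \is a GRing.unit.
Proof.
move=> ij; apply/unitrP; exists (elemmx i j (- a)).
by rewrite -!elemmxD // addNr subrr elemmx0.
Qed.

Definition elem i j (ij : i != j) a : units M := Units (elemmx_unit a ij).

Lemma elemD i j (ij : i != j) a b :
  elem ij (a + b) = (elem ij a * elem ij b)%g.
Proof. by apply/val_inj; rewrite units_valM /= elemmxD. Qed.

Lemma elem_commute i j k l (ij : i != j) (kl : k != l) a b :
  j != k -> l != i -> commute (elem ij a) (elem kl b).
Proof.
move=> jk li; apply/val_inj; rewrite !units_valM /= !elemmxM.
by rewrite (negPf jk) (negPf li) !addr0 addrAC.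
Qed.

Lemma elem_commutator i j k (ij : i != j) (jk : j != k) (ik : i != k) a b :
  (elem ij a * elem jk b = elem jk b * elem ij a * elem ik (a * b)%R)%g.
Proof.
apply/val_inj; rewrite !units_valM /= !elemmxM eqxx.
rewrite [k == i]eq_sym (negPf ik) addr0.
rewrite /elemmx mulrDr mulr1 !mulrDl mul1r !delta_mul.
rewrite [j == i]eq_sym (negPf ij) [k == i]eq_sym (negPf ik) !addr0.
by rewrite (addrAC 1).
Qed.

End Elementary.

(** * The example *)

Lemma heisenberg_generated (G : groupType) (X : set G) (F : finFieldType)
    (x y z : F -> generated_subgroup X) :
  heisenberg (fun a => val (x a)) (fun a => val (y a)) (fun a => val (z a)) ->
  heisenberg x y z.
Proof.
move=> [[xD yD zD] xy zx zy].
split; [split| | |] => a b; apply/val_inj; rewrite ?valM.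
- exact: xD.
- exact: yD.
- exact: zD.
- exact: xy.
- exact: zx.
- exact: zy.
Qed.

Section Example.
Variables (R : realType) (F : finFieldType).

(** The additive factor only serves to provide a locally finite quotient. *)
Definition mx_group : Type :=
  (units 'M[{poly F}]_3 * Algebra.to_multiplicative {poly F})%type.
HB.instance Definition _ := Group.on mx_group.

Implicit Types (i j k l : 'I_3) (p q : {poly F}).

Definition embed (u : units 'M[{poly F}]_3) : mx_group := (u, 1%g).

Lemma embedM u v : embed (u * v)%g = (embed u * embed v)%g.
Proof. by congr (_, _); rewrite mulg1. Qed.

Definition root i j (ij : i != j) p : mx_group := embed (elem ij p).

Lemma rootD i j (ij : i != j) p q : root ij (p + q) = (root ij p * root ij q)%g.
Proof. by rewrite /root elemD embedM. Qed.

Lemma root_commute i j k l (ij : i != j) (kl : k != l) p q :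
  j != k -> l != i -> commute (root ij p) (root kl q).
Proof. by move=> jk li; rewrite /commute -!embedM elem_commute. Qed.

Lemma root_commutator i j k (ij : i != j) (jk : j != k) (ik : i != k) p q :
  (root ij p * root jk q = root jk q * root ij p * root ik (p * q)%R)%g.
Proof. by rewrite -!embedM -elem_commutator. Qed.

Let e01 : (0 : 'I_3) != 1 := isT.
Let e12 : (1 : 'I_3) != 2%:R := isT.
Let e20 : (2%:R : 'I_3) != 0 := isT.
Let e02 : (0 : 'I_3) != 2%:R := isT.
Let e10 : (1 : 'I_3) != 0 := isT.
Let e21 : (2%:R : 'I_3) != 1 := isT.

Definition root_elements : set mx_group :=
  [set g | exists a : F, [\/ g = root e01 a%:P, g = root e12 a%:P |
                             g = root e20 (a *: 'X)]].

Local Notation Gamma := (generated_subgroup root_elements).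
Local Notation gen := (generated root_elements).

Let gen01 a : gen (root e01 a%:P).
Proof. by apply: sub_generated; exists a; constructor 1. Qed.
Let gen12 a : gen (root e12 a%:P).
Proof. by apply: sub_generated; exists a; constructor 2. Qed.
Let gen20 a : gen (root e20 (a *: 'X)).
Proof. by apply: sub_generated; exists a; constructor 3. Qed.

Let gen_comm i j k (ij : i != j) (jk : j != k) (ik : i != k) p q :
  gen (root ij p) -> gen (root jk q) -> gen (root ik (p * q)).
Proof. by apply: generated_commutator; exact: root_commutator. Qed.

Let gen02 a : gen (root e02 a%:P).
Proof.
have := gen_comm e02 (gen01 a) (gen12 1); rewrite mulr1; exact.
Qed.
Let gen10 a : gen (root e10 (a *: 'X)).
Proof. by have := gen_comm e10 (gen12 1) (gen20 a); rewrite mul1r. Qed.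
Let gen21 a : gen (root e21 (a *: 'X)).
Proof. by have := gen_comm e21 (gen20 a) (gen01 1); rewrite mulr1. Qed.

(** Commutators carry [t^n] around the triangle of roots: from [e_12] to [e_13]
    with [e_23(1)], then back to [e_12] with [e_32(t)]. *)
Lemma gen_Xn n : gen (root e01 'X^n).
Proof.
elim: n => [|n IHn]; first exact: gen01.
have := gen_comm e01 (gen_comm e02 IHn (gen12 1)) (gen21 1).
by rewrite mulr1 scale1r -exprSr.
Qed.

Lemma root_heisenberg i j k (ij : i != j) (jk : j != k) (ik : i != k)
    (f g h : F -> {poly F}) :
  {morph f : a b / a + b} -> {morph g : a b / a + b} -> {morph h : a b / a + b} ->
  (forall a b, f a * g b = h (a * b)) ->
  heisenberg (fun a => root ij (f a)) (fun a => root jk (g a))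
    (fun a => root ik (h a)).
Proof.
move=> fD gD hD fg; split; first split.
- by move=> a b; rewrite fD rootD.
- by move=> a b; rewrite gD rootD.
- by move=> a b; rewrite hD rootD.
- by move=> a b; rewrite root_commutator fg.
- by move=> c a; apply: root_commute; rewrite eq_sym.
- by move=> c b; apply: root_commute; rewrite eq_sym.
Qed.

Lemma Gamma_kazhdan : (4 < #|F|)%N -> kazhdan R Gamma.
Proof.
move=> F4 H pi pi_rep pi_triv.
pose x a : Gamma := to_generated (gen01 a).
pose y a : Gamma := to_generated (gen12 a).
pose t a : Gamma := to_generated (gen20 a).
pose xy a : Gamma := to_generated (gen02 a).
pose yt a : Gamma := to_generated (gen10 a).
pose tx a : Gamma := to_generated (gen21 a).
have polyCD' : {morph (fun a : F => a%:P) : a b / a + b} by move=> a b; rewrite polyCD.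
have scaleD : {morph (fun a : F => a *: 'X) : a b / a + b}.
  by move=> a b; rewrite scalerDl.
have hxy : heisenberg x y xy.
  apply: heisenberg_generated; apply: root_heisenberg => // a b.
  by rewrite polyCM.
have hyt : heisenberg y t yt.
  apply: heisenberg_generated; apply: root_heisenberg => // a b.
  by rewrite mul_polyC scalerA.
have htx : heisenberg t x tx.
  apply: heisenberg_generated; apply: root_heisenberg => // a b.
  by rewrite mulrC mul_polyC scalerA mulrC.
have [w [w0 xw yw tw]] := triangle_invariant_vector F4 hxy hyt htx pi_rep pi_triv.
exists w => //; apply: generated_subgroup_ind.
- by case: pi_rep.
- by move=> g h gw hw; case: pi_rep => _ _ ->; rewrite hw.
- move=> g gw; case: pi_rep => _ pi1 piM.
  by rewrite -{1}gw -piM mulVg pi1.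
move=> g [a [ga|ga|ga]].
- by rewrite (_ : g = x a) ?xw //; exact/val_inj.
- by rewrite (_ : g = y a) ?yw //; exact/val_inj.
- by rewrite (_ : g = t a) ?tw //; exact/val_inj.
Qed.

Lemma mx_group_countable (A : set mx_group) : countable A.
Proof.
apply/countable_injP.
exists (fun g : mx_group => pickle (val g.1 : 'M[{poly F}]_3, g.2 : {poly F})).
move=> [g a] [h b] _ _ /(pcan_inj pickleK) [gh ->].
by congr (_, _); exact/val_inj.
Qed.

Lemma root_inj i j (ij : i != j) : injective (root ij).
Proof.
move=> p q [] /matrixP /(_ i j); rewrite !mxE !eqxx (negPf ij) !mulr1.
by move=> /addrI.
Qed.

Let root_Xn_inj : injective (fun n => root e01 'X^n).
Proof.
move=> m n /root_inj /(congr1 (fun p : {poly F} => size p)).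
by rewrite !size_polyXn => -[].
Qed.

Lemma mx_group_infinite : countably_infinite [set: mx_group].
Proof. by apply: (countably_infiniteI _ root_Xn_inj) => //; exact: mx_group_countable. Qed.

Lemma Gamma_infinite : countably_infinite [set: Gamma].
Proof.
apply: (@countably_infiniteI _ _ (fun n => to_generated (gen_Xn n))) => //.
  apply: (@sub_countable _ _ _ (range (val : Gamma -> mx_group))).
    by have /card_eqPle[] := @inj_card_eq _ _ [set: Gamma]
      (val : Gamma -> mx_group) (in2W val_inj).
  exact: mx_group_countable.
by move=> m n /(congr1 val) /root_Xn_inj.
Qed.

Lemma mx_group_framenable : framenable R mx_group.
Proof.
(* The polynomials with at most [n] coefficients. *)
pose A n := undup [seq \poly_(i < n) (if insub i is Some o then c o else 0) |
   c : {ffun 'I_n -> F} <- enum {: {ffun 'I_n -> F}}].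
have memA n (p : {poly F}) : (p \in A n) = (size p <= n)%N.
  rewrite mem_undup; apply/mapP/idP => [[c _ ->]|pn]; first exact: size_poly.
  exists [ffun o : 'I_n => p`_o]; first by rewrite mem_enum.
  apply/polyP => i; rewrite coef_poly.
  case: ltnP => [ltin|nin]; first by rewrite insubT ffunE.
  by rewrite nth_default // (leq_trans pn).
apply: (@framenable_of_locally_finite_quotient R mx_group {poly F}
  (fun g => g.2) (fun p => (1%g, p)) A (fun n => 'X^n)) => //.
- by move=> m n /(congr1 (fun p : {poly F} => size p)); rewrite !size_polyXn => -[].
- by move=> n; exact: undup_uniq.
- move=> n; have : 0 \in A n by rewrite memA size_poly0.
  by case: (A n).
move=> u; exists (size u) => m um t; rewrite !memA.
apply/idP/idP => tm; last by rewrite (leq_trans (size_polyD _ _)) // size_polyN geq_max tm.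
by rewrite -[t](subrK u) (leq_trans (size_polyD _ _)) // geq_max tm.
Qed.

End Example.

Theorem corollary3p10 :
  forall R : realType,
    (exists (G : groupType) (P : pred G) (N : subGroupType P),
        [/\ countably_infinite [set: G],
            framenable R G,
            countably_infinite [set: N] &
            ~ framenable R N])
    /\
    (exists G : groupType,
        [/\ countably_infinite [set: G],
            framenable R G &
            ~ haagerup R G]).
Proof.
move=> R; have F5 : (4 < #|'F_5|)%N by rewrite card_Fp.
have GammaT := Gamma_kazhdan (R := R) F5.
split.
  exists (mx_group 'F_5 : groupType), (generated_pred (@root_elements 'F_5)).
  exists (generated_subgroup (@root_elements 'F_5)); split.
  - exact: mx_group_infinite.
  - exact: mx_group_framenable.
  - exact: Gamma_infinite.
  - exact: kazhdan_not_framenable.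
exists (mx_group 'F_5 : groupType); split.
- exact: mx_group_infinite.
- exact: mx_group_framenable.
- apply: kazhdan_subgroup_not_haagerup GammaT.
  exact/infinite_countably_infinite/Gamma_infinite.
Qed.
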